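(* Let $L>0$, let $K$ be a kernel satisfying the kernel conditions (K), let $h>0$ be the bandwidth, and let $q>0$, $M>0$, $R>0$. Let $\mu_1,\dots,\mu_n$ be i.i.d. random persistence measures on $\Omega$, with persistence intensity function $p$ and persistence density function $\tilde p$, satisfying: (i) (bounded total persistence) almost surely, $\max_{1\le i\le n}\int_\Omega\|\bm\omega-\partial\Omega\|_2^q\,\mathrm d\mu_i(\bm\omega)<M$; (ii) (boundedness) with $\bar p(\bm\omega):=\|\bm\omega-\partial\Omega\|_2^q\,p(\bm\omega)$, one has $\|\bar p\|_\infty<\infty$ and $\|\tilde p\|_\infty<\infty$. Then: (a) There exist constants $C_1,C_2$ depending on $M,\|K\|_\infty,\|K\|_2,\|\bar p\|_\infty$ and $q$ such that for any $\delta\in(0,1)$, with probability at least $1-\delta$, $$\sup_{\Psi\in\mathscr F_{2h,R}}\big|\hat\Psi_h-\mathbb E[\hat\Psi_h]\big|\le R\cdot\max\left\{C_1\frac1{nh^2}\log\frac1{\delta h^2},\;C_2\sqrt{\frac1{nh^2}}\sqrt{\log\frac1{\delta h^2}}\right\}.$$ (b) There exist constants $C_1,C_2$ depending on $M,\|K\|_\infty,\|K\|_2,\|\tilde p\|_\infty$ and $q$ such that for any $\delta\in(0,1)$, with probability at least $1-\delta$, $$\sup_{\Psi\in\widetilde{\mathscr F}_R}\big|\check\Psi_h-\mathbb E[\check\Psi_h]\big|\le R\cdot\max\left\{C_1\frac1{nh^2}\log\frac1{\delta h^2},\;C_2\sqrt{\frac1{nh^2}}\sqrt{\log\frac1{\delta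 h^2}}\right\}.$$
   Context: $\Omega=\{(b,d):0<b<d\le L\}\subset\mathbb R^2$, $\partial\Omega=\{(x,x):0\le x\le L\}$, $\|\bm\omega-\partial\Omega\|_2=\min_{\bm x\in\partial\Omega}\|\bm\omega-\bm x\|_2$, $\Omega_\ell=\{\bm\omega\in\Omega:\|\bm\omega-\partial\Omega\|_2\ge\ell\}$, and $\ell_{\bm\omega}=\|\bm\omega-\partial\Omega\|_2-h$. For $f$ on $\Omega$, $\|f\|_\infty=\sup_\Omega|f|$. A persistence measure is the counting measure $\mu=\sum_{i=1}^{N(D)}\delta_{\bm r_i}$ of a persistence diagram $D=\{\bm r_i\}$, a multiset of points of $\Omega$; its normalization is $\tilde\mu=\frac1{N(D)}\mu$. For a random persistence diagram, $\mathbb E[\mu]$ and $\mathbb E[\tilde\mu]$ denote the measures $A\mapsto\mathbb E[\mu(A)]$ and $A\mapsto\mathbb E[\tilde\mu(A)]$; the persistence intensity function $p$ and the persistence density function $\tilde p$ are their Lebesgue densities on $\Omega$ (assumed to exist). Kernel conditions (K) on $K:\mathbb R^2\to\mathbb R$: $K(\bm x)=0$ when $\|\bm x\|_2>1$; $\|K\|_\infty=\sup|K|<\infty$; $\int_{\mathbb R^2}K=1$; $\|K\|_2^2=\int_{\mathbb R^2}K^2<\infty$; there is a positive integer $s$ with $\int x_1^{s_1}x_2^{s_2}K(\bm x)\,\mathrm d\bm x=0$ for all non-negative integers $s_1,s_2$ with $1\le s_1+s_2<s$; $K$ is $L_K$-Lipschitz in the Euclidean norm. For bandwidth $h>0$,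 $K_h(\bm x)=h^{-2}K(\bm x/h)$, $\hat p_h(\bm\omega)=\frac1n\sum_{i=1}^n\int_\Omega K_h(\bm x-\bm\omega)\,\mathrm d\mu_i(\bm x)$ and $\check p_h(\bm\omega)=\frac1n\sum_{i=1}^n\int_\Omega K_h(\bm x-\bm\omega)\,\mathrm d\tilde\mu_i(\bm x)$. Classes of linear representations: $$\mathscr F_{2h,R}=\Big\{\Psi=\int_{\Omega_{2h}}f\,\mathrm d\mathbb E[\mu]\;\Big|\;f:\Omega_{2h}\to\mathbb R_{\ge0},\ \int_{\Omega_{2h}}\ell_{\bm\omega}^{-q}f(\bm\omega)\,\mathrm d\bm\omega\le R\Big\},$$ $$\widetilde{\mathscr F}_R=\Big\{\Psi=\int_\Omega f\,\mathrm d\mathbb E[\tilde\mu]\;\Big|\;f:\Omega\to\mathbb R_{\ge0},\ \int_\Omega f(\bm\omega)\,\mathrm d\bm\omega\le R\Big\},$$ with $f$ measurable. The corresponding estimators, indexed by the same $f$ (so the suprema are over all such $f$), are $\hat\Psi_h=\int_{\Omega_{2h}}f\,\hat p_h\,\mathrm d\bm\omega$ for $\mathscr F_{2h,R}$ and $\check\Psi_h=\int_\Omega f\,\check p_h\,\mathrm d\bm\omega$ for $\widetilde{\mathscr F}_R$.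
   Formalization: The bandwidth is restricted to 0 < h ≤ h0 for an arbitrary fixed h0 < 1, and the constants C_1, C_2 may also depend on h0 and on the Lipschitz constant L_K of the kernel; with constants independent of these, or with h > 1, the printed claim fails. *)

(* Defs.v *)
From HB Require Import structures.
From mathcomp Require Import all_boot all_order all_algebra.
From mathcomp Require Import all_classical all_reals all_analysis.
From mathcomp Require Import measurable_realfun.

Set Implicit Arguments.
Unset Strict Implicit.
Unset Printing Implicit Defensive.

Import Order.TTheory GRing.Theory Num.Theory.
Import numFieldNormedType.Exports.

Local Open Scope classical_set_scope.
Local Open Scope ring_scope.

(* R^2 with its Borel sigma-algebra; [measurableTypeR R] is the copy of R on
   which [lebesgue_measure] lives. *)
Notation plane R := (measurableTypeR R * measurableTypeR R)%type.

Section Plane.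
Context {R : realType}.

(* The library norm on R * R is the max norm, hence this definition. *)
Definition enorm (x : plane R) : R := Num.sqrt (x.1 ^+ 2 + x.2 ^+ 2).

Definition leb2 : {measure set (plane R) -> \bar R} :=
  (@lebesgue_measure R \x @lebesgue_measure R)%E.

(* [supnorm A f] is meaningful only for f bounded on A, see [sup_finite]. *)
Definition supnorm (A : set (plane R)) (f : plane R -> R) : R :=
  sup [set `|f x| | x in A].

Definition sup_finite (A : set (plane R)) (f : plane R -> R) : Prop :=
  has_ubound [set `|f x| | x in A].

Definition Omega (L : R) : set (plane R) :=
  [set w | 0 < w.1 /\ w.1 < w.2 /\ w.2 <= L].

Definition diagonal (L : R) : set (plane R) :=
  [set w | 0 <= w.1 <= L /\ w.2 = w.1].

Definition dist_diag (L : R) (w : plane R) : R :=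
  inf [set enorm (w - x) | x in diagonal L].

Definition Omega_ge (L l : R) : set (plane R) :=
  [set w | Omega L w /\ l <= dist_diag L w].

End Plane.

Section Kernel.
Context {R : realType}.

Definition kernel_scale (K : plane R -> R) (h : R) (x : plane R) : R :=
  h ^- 2 * K (x.1 / h, x.2 / h).

Definition l2norm (K : plane R -> R) : R :=
  Num.sqrt (\int[leb2]_x (K x ^+ 2)).

Record kernel_conditions (K : plane R -> R) (LK : R) : Prop := {
  kernel_support : forall x, 1 < enorm x -> K x = 0;
  kernel_bounded : sup_finite setT K;
  kernel_int1 : (\int[leb2]_x (K x)%:E = 1)%E;
  kernel_sqr_int : (\int[leb2]_x (K x ^+ 2)%:E < +oo)%E;
  kernel_moments : exists s : nat, (0 < s)%N /\
    forall s1 s2 : nat, (1 <= s1 + s2 < s)%N ->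
      (\int[leb2]_x (x.1 ^+ s1 * x.2 ^+ s2 * K x)%:E = 0)%E;
  kernel_lipschitz : forall x y, `|K x - K y| <= LK * enorm (x - y)
}.

End Kernel.

Section PersistenceMeasure.
Context {R : realType}.

(* A finite multiset of points is represented by a sequence listing it; all
   notions below depend on the sequence only through its counting measure. *)
Definition pers_measure (D : seq (plane R)) : {measure set (plane R) -> \bar R} :=
  msum (fun k => @dirac _ (plane R) (nth 0 D k) R) (size D).

(* Since 0^-1 = 0, the empty diagram is normalized to the zero measure. *)
Definition npers_measure (D : seq (plane R)) : {measure set (plane R) -> \bar R} :=
  mscale ((size D)%:R^-1)%:nng (pers_measure D).

Definition count_events : set (set (seq (plane R))) :=
  [set [set D | B (pers_measure D A)] |
     A in (measurable : set (set (plane R))) &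
     B in (measurable : set (set (\bar R)))].

End PersistenceMeasure.

HB.instance Definition _ (R : realType) :=
  isPointed.Build (seq (plane R)) [::].

(* Diagrams with the sigma-algebra generated by the evaluations
   D |-> mu_D(A), A Borel: a measurable map into [diagram R] is exactly a
   random persistence measure. *)
Definition diagram (R : realType) := g_sigma_algebraType (@count_events R).

Section Sample.
Context {R : realType} {d : measure_display} {T : measurableType d}.
Context (P : probability T R) {n : nat}.
Implicit Types D : 'I_n -> {RV P >-> diagram R}.

Definition mutually_independent D : Prop :=
  forall (J : {set 'I_n}) (S : 'I_n -> set (diagram R)),
    (forall i, measurable (S i)) ->
    P (\bigcap_(i in [set i | i \in J]) (D i @^-1` S i)) =
    (\prod_(i in J) P (D i @^-1` S i))%E.

Definition identically_distributed D : Prop :=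
  forall (i j : 'I_n) (S : set (diagram R)), measurable S ->
    distribution P (D i) S = distribution P (D j) S.

Definition iid_on (L : R) D : Prop :=
  [/\ mutually_independent D, identically_distributed D
    & forall i t x, x \in (D i t : seq (plane R)) -> Omega L x].

Definition mean_measure (nu : T -> {measure set (plane R) -> \bar R})
    (A : set (plane R)) : \bar R := (\int[P]_t nu t A)%E.

Definition is_density (L : R) (m : set (plane R) -> \bar R) (p : plane R -> R)
    : Prop :=
  [/\ measurable_fun (Omega L) p, (forall x, Omega L x -> 0 <= p x)
    & forall A, measurable A -> A `<=` Omega L ->
        m A = (\int[leb2]_(x in A) (p x)%:E)%E].

Definition is_intensity L D p : Prop :=
  forall i, is_density L (mean_measure (fun t => pers_measure (D i t))) p.

Definition is_density_function L D p : Prop :=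
  forall i, is_density L (mean_measure (fun t => npers_measure (D i t))) p.

Definition kernel_average (L : R) (K : plane R -> R) (h : R)
    (nu : 'I_n -> {measure set (plane R) -> \bar R}) (w : plane R) : R :=
  n%:R^-1 * \sum_(i < n) \int[nu i]_(x in Omega L) kernel_scale K h (x - w).

Definition phat L K h D (t : T) : plane R -> R :=
  kernel_average L K h (fun i => pers_measure (D i t)).

Definition pcheck L K h D (t : T) : plane R -> R :=
  kernel_average L K h (fun i => npers_measure (D i t)).

Definition Psi_hat L K h D (f : plane R -> R) (t : T) : R :=
  \int[leb2]_(w in Omega_ge L (2 * h)) (f w * phat L K h D t w).

Definition Psi_check L K h D (f : plane R -> R) (t : T) : R :=
  \int[leb2]_(w in Omega L) (f w * pcheck L K h D t w).

(* [E] holds with probability at least [c]; no measurability of [E] itself is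
   presupposed. *)
Definition with_prob_ge (c : R) (E : set T) : Prop :=
  exists A, [/\ measurable A, A `<=` E & (c%:E <= P A)%E].

Definition sup_deviation (F : set (plane R -> R)) (Psi : (plane R -> R) -> T -> R)
    (t : T) : \bar R :=
  ereal_sup [set `|(Psi f t)%:E - 'E_P[Psi f]|%E | f in F].

End Sample.

(* The classes of linear representations are given by their sets of indices f;
   f is irrelevant outside the domain of integration. *)
Definition class_intensity {R : realType} (L h q r : R)
    : set (plane R -> R) :=
  [set f : plane R -> R | [/\ measurable_fun (Omega_ge L (2 * h)) f,
    (forall w, Omega_ge L (2 * h) w -> 0 <= f w)
    & (\int[leb2]_(w in Omega_ge L (2 * h))
         ((dist_diag L w - h) `^ (- q) * f w)%:E <= r%:E)%E]].

Definition class_density {R : realType} (L r : R) : set (plane R -> R) :=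
  [set f : plane R -> R | [/\ measurable_fun (Omega L) f, (forall w, Omega L w -> 0 <= f w)
    & (\int[leb2]_(w in Omega L) (f w)%:E <= r%:E)%E]].

Definition deviation_bound {R : realType} (C1 C2 : R) (n : nat) (h delta : R)
    : R :=
  Num.max (C1 * (n%:R * h ^+ 2)^-1 * ln ((delta * h ^+ 2)^-1))
    (C2 * Num.sqrt ((n%:R * h ^+ 2)^-1) * Num.sqrt (ln ((delta * h ^+ 2)^-1))).

(* Main.v *)
(* Write m = n h^2 and Lam = ln (1 / (delta h^2)), so that Lam is bounded below by
   ln (1 / h0^2) > 0.  By duality both suprema are r times the supremum over w of a
   weighted deviation of the kernel estimator at w.  The plane is cut into square
   cells of side h / 8; on the cell j the weight is comparable to a constant
   [Wc j], and [Wc j] times the mass of the j-th box (the union of the supports of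
   the kernels centred in the cell) is at most M, has mean O(h^2), and these means
   sum to O(M), because the boxes overlap at most 19^2 = 361 times.

   With theta = min (1, sqrt (Lam / m)), the sum over all dyadic increments of
   all cells of
     8^-k (cosh (theta (4/3)^k (centred increment of level k)) - 1)
   has expectation at most exp (O(Lam)).  The function cosh - 1 is what makes this
   uniform in L: it vanishes at 0, so its expectation is linear in the mean mass of
   the box, however many boxes there are.  Markov's inequality then bounds all
   increments at once, and chaining inside a cell gives
     theta * deviation = O(Lam),
   that is, a deviation of the sums of order max (Lam, sqrt (m Lam)). *)
Require Import Defs.
From HB Require Import structures.
From mathcomp Require Import all_boot all_order all_algebra.
From mathcomp Require Import all_classical all_reals all_analysis.
From mathcomp Require Import measurable_realfun.
From mathcomp Require Import ring lra.

Set Implicit Arguments.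
Unset Strict Implicit.
Unset Printing Implicit Defensive.

Import Order.TTheory GRing.Theory Num.Theory.
Import numFieldNormedType.Exports.

Local Open Scope classical_set_scope.
Local Open Scope ring_scope.

(** * Joint measurability *)

(** The bases 8, 4/3 and 3/4 are tied together. A cell has [4^k] points of level [k], so the weight
    [8^-k] leaves the summable factor [2^-k]. An increment of level [k] is of order [2^-k], so its
    multiplier may grow like [(4/3)^k] without spoiling the exponential bounds; this growth makes
    the thresholds that follow from Markov's inequality, about [(3/4)^k (k ln 8 + ln c) / theta],
    summable over the levels. Chaining stops at a level [k0] that depends on [n]; beyond it the
    Lipschitz bound alone suffices. The estimates are uniform in [k0], and the good event is cut out
    by finitely many increments and one null set, so it is measurable although the deviation is a
    supremum over uncountably many points. The [h^-2] under the logarithm comes from the sum over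
    all cells: the second moments add up to order [theta^2 n], whereas one cell has only
    [theta^2 n h^2 <= Lam]. The lost factor [h^-2] is at most [exp Lam], and so is [1 / delta]. The
    Lipschitz constant enters through the chaining and [h0] through the lower bound on Lam; both are
    fixed before the constants are chosen. *)

Lemma cvg_floor_grid (R : realType) (y : R) :
  (Num.floor (k.+1%:R * y))%:~R / k.+1%:R @[k --> \oo] --> y.
Proof.
apply/cvgrPdist_le => e e0; near=> k.
have k0 : (0 : R) < k.+1%:R by [].
have := ge_floor (k.+1%:R * y); have := ltW (floorD1_gt (k.+1%:R * y)).
set z : R := (Num.floor _)%:~R => h1 h2.
have hk : k.+1%:R^-1 <= e.
  near: k; have := @near_infty_natSinv_lt R (PosNum e0).
  by apply: filterS => k /= /ltW.
have -> : y - z / k.+1%:R = (k.+1%:R * y - z) / k.+1%:R by field; lra.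
apply: le_trans hk; rewrite normrM [X in _ * X]gtr0_norm ?invr_gt0//.
rewrite ler_piMl ?invr_ge0//; move: h1; rewrite intrD -/z => h1.
by rewrite ger0_norm; lra.
Unshelve. all: by end_near. Qed.

(** Freezing [y] at the left end of its interval in the grid of mesh [1 / (k + 1)] leaves countably
    many measurable strips; continuity in [y] recovers [G] as the pointwise limit of these
    functions. *)
Lemma measurable_caratheodory (R : realType) d (X : measurableType d)
    (G : X * measurableTypeR R -> R) :
  (forall y, measurable_fun setT (fun x => G (x, y))) ->
  (forall x, continuous (fun y : R => G (x, y))) ->
  measurable_fun setT G.
Proof.
move=> mG cG.
pose h k (xy : X * measurableTypeR R) : R :=
  G (xy.1, (Num.floor (k.+1%:R * (xy.2 : R)))%:~R / k.+1%:R).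
apply: (@measurable_fun_cvg _ _ _ _ h); last first.
  move=> [x y] _ /=; apply: (continuous_cvg _ (cG x y)).
  exact: cvg_floor_grid.
move=> k _ B mB; rewrite setTI.
have -> : h k @^-1` B = \bigcup_(z : int)
    ([set x | B (G (x, z%:~R / k.+1%:R))] `*`
      [set` `[z%:~R / k.+1%:R, (z + 1)%:~R / k.+1%:R[%R]).
  apply/seteqP; split => [[x y] /= Bxy|[x y] [z _] [/= Bz]].
    exists (Num.floor (k.+1%:R * (y : R))) => //; split => //=.
    rewrite in_itv/= ler_pdivrMr// ltr_pdivlMr// ![y * _]mulrC.
    by rewrite ge_floor floorD1_gt.
  rewrite in_itv/= ler_pdivrMr// ltr_pdivlMr// ![y * _]mulrC => yz.
  by rewrite /h/= (floor_def yz).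
apply: countable_bigcupT_measurable => // z; apply: measurableX.
  by rewrite -[X in measurable X]setTI; exact: mG.
exact: measurable_itv.
Qed.

Lemma measurable_plane_caratheodory (R : realType) d (X : measurableType d)
    (G : X -> plane R -> R) (l : X -> R) :
  (forall w, measurable_fun setT (G ^~ w)) ->
  (forall x v w, `|G x v - G x w| <= l x * (`|v.1 - w.1| + `|v.2 - w.2|)) ->
  measurable_fun setT (fun xw : X * plane R => G xw.1 xw.2).
Proof.
move=> mG lG.
have contl (g : R -> R) c : (forall u v, `|g u - g v| <= c * `|u - v|) ->
    continuous g.
  move=> lg u; apply/cvgrPdist_le => e e0.
  have [c0|c0] := leP c 0.
    near=> v; apply: (le_trans (lg u v)).
    by apply: (le_trans _ (ltW e0)); rewrite mulr_le0_ge0.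
  have ec : 0 < e / c by rewrite divr_gt0.
  near=> v; apply: (le_trans (lg u v)).
  by rewrite mulrC -ler_pdivlMr//; near: v; exact: nbhs_le_dist.
(* The two coordinates of the plane are adjoined to [X] one after the other, each by the
   one-variable lemma. *)
pose G1 (z : X * measurableTypeR R * measurableTypeR R) :=
  G z.1.1 (z.1.2, z.2).
have mG1 : measurable_fun setT G1.
  apply: measurable_caratheodory => [b|[x a]].
    apply: (@measurable_caratheodory _ _ _ (fun xa => G xa.1 (xa.2, b))).
      by move=> a; exact: (mG (a, b)).
    move=> x; apply: (@contl _ (l x)) => u v.
    by apply: (le_trans (lG _ _ _)); rewrite /= subrr normr0 addr0.
  apply: (@contl _ (l x)) => u v.
  by apply: (le_trans (lG _ _ _)); rewrite /= subrr normr0 add0r.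
rewrite (_ : (fun _ => _) =
  G1 \o (fun z : X * plane R => ((z.1, z.2.1), z.2.2))); last first.
  by apply/funext => -[x [a b]].
apply: measurableT_comp => //.
apply/measurable_fun_pairP; split => /=.
  apply/measurable_fun_pairP; split => /=; first exact: measurable_fst.
  by apply: (measurableT_comp measurable_fst measurable_snd).
by apply: (measurableT_comp measurable_snd measurable_snd).
Unshelve. all: by end_near. Qed.

(** * Independence and exponential moments *)

Section Independence.
Context {R : realType} {d : measure_display} {T : measurableType d}.
Context (P : probability T R).
Local Open Scope ereal_scope.
Import HBNNSimple.

(** Standard extension from indicators to simple functions by linearity, then to nonnegative
    measurable functions by monotone convergence. It serves to replace one indicator in a product of
    independent factors by an arbitrary function. *)
Lemma indicator_product_ext d' (E : measurableType d') (X : T -> \bar R)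
    (Y : T -> E) (c : \bar R) (g : E -> \bar R) :
  measurable_fun setT X -> (forall t, 0 <= X t) -> measurable_fun setT Y ->
  c \is a fin_num -> 0 <= c ->
  (forall t, X t \is a fin_num) ->
  (forall S, measurable S ->
    \int[P]_t (X t * (\1_S (Y t))%:E) = c * \int[P]_t (\1_S (Y t))%:E) ->
  measurable_fun setT g -> (forall x, 0 <= g x) ->
  \int[P]_t (X t * g (Y t)) = c * \int[P]_t g (Y t).
Proof.
move=> mX X0 mY cfin c0 Xfin H mg g0.
pose h := nnsfun_approx measurableT mg.
have hg x : (EFin \o h^~ x) k @[k --> \oo] --> g x.
  exact: cvg_nnsfun_approx.
have mh k : measurable_fun setT (fun t => (h k (Y t))%:E).
  by apply/measurable_EFinP; apply: measurableT_comp.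
have key k : \int[P]_t (X t * (h k (Y t))%:E) = c * \int[P]_t (h k (Y t))%:E.
  have fE t : (h k (Y t))%:E =
      \sum_(y \in range (h k)) (y%:E * (\1_(h k @^-1` [set y]) (Y t))%:E).
    by rewrite [X in X%:E](fimfunE (h k) (Y t)) -fsumEFin.
  have mind y : measurable_fun setT
      (fun t => (\1_(h k @^-1` [set y]) (Y t))%:E : \bar R).
    by apply/measurable_EFinP; apply: measurableT_comp.
  have -> : \int[P]_t (X t * (h k (Y t))%:E) = \int[P]_t
      (\sum_(y \in range (h k)) X t * (y%:E * (\1_(h k @^-1` [set y]) (Y t))%:E)).
    apply: eq_integral => t _; rewrite fE ge0_mule_fsumr// => y.
    exact: nnfun_muleindic_ge0.
  have -> : \int[P]_t (h k (Y t))%:E = \int[P]_t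
      (\sum_(y \in range (h k)) (y%:E * (\1_(h k @^-1` [set y]) (Y t))%:E)).
    by apply: eq_integral => t _; rewrite fE.
  rewrite ge0_integral_fsum//; last 2 first.
    move=> y; apply: emeasurable_funM => //.
    exact: measurable_funeM.
    by move=> y t _; rewrite mule_ge0//; exact: nnfun_muleindic_ge0.
  rewrite ge0_integral_fsum//; last 2 first.
    by move=> y; exact: measurable_funeM.
    by move=> y t _; exact: nnfun_muleindic_ge0.
  rewrite ge0_mule_fsumr; last first.
    by move=> y; apply: integral_ge0 => t _; exact: nnfun_muleindic_ge0.
  apply: eq_fsbigr => y /set_mem[x _ <-].
  under eq_integral do rewrite muleCA.
  rewrite ge0_integralZl_EFin//; last 2 first.
    by move=> t _; rewrite mule_ge0// lee_fin.
    exact: emeasurable_funM.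
  rewrite [in RHS]ge0_integralZl_EFin//.
  by rewrite H// muleCA.
have monoh t : {homo (fun k => (h k (Y t))%:E) : a b / (a <= b)%N >-> a <= b}.
  by move=> a b ab; rewrite lee_fin; exact/lefP/nd_nnsfun_approx.
have cvgL : (fun k => \int[P]_t (X t * (h k (Y t))%:E)) @ \oo -->
    \int[P]_t (X t * g (Y t)).
  have -> : \int[P]_t (X t * g (Y t)) =
      \int[P]_t limn (fun k => X t * (h k (Y t))%:E).
    apply: eq_integral => t _; apply/esym/cvg_lim => //.
    by apply: cvgeZl => //; exact: hg.
  apply: cvg_monotone_convergence => //.
  - by move=> k; exact: emeasurable_funM.
  - by move=> k t _; rewrite mule_ge0// lee_fin.
  - by move=> t _ a b ab; apply: lee_wpmul2l => //; exact: monoh.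
have cvgR : (fun k => c * \int[P]_t (h k (Y t))%:E) @ \oo -->
    c * \int[P]_t g (Y t).
  apply: cvgeZl => //.
  have -> : \int[P]_t g (Y t) = \int[P]_t limn (fun k => (h k (Y t))%:E).
    by apply: eq_integral => t _; apply/esym/cvg_lim => //; exact: hg.
  apply: cvg_monotone_convergence => //.
  by move=> k t _; rewrite lee_fin.
apply: (cvg_unique _ cvgL) => //.
by move: cvgR; under eq_fun do rewrite -key.
Qed.

End Independence.

Section IndependentProduct.
Context {R : realType} {d : measure_display} {T : measurableType d}.
Context (P : probability T R) (n : nat).
Local Open Scope ereal_scope.

Lemma expectation_indep_prod (D : 'I_n -> {RV P >-> diagram R})
    (g : 'I_n -> diagram R -> R) :
  mutually_independent D ->
  (forall i, measurable_fun setT (g i)) ->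
  (forall i x, (0 <= g i x)%R) ->
  (forall i, \int[P]_t (g i (D i t))%:E < +oo) ->
  \int[P]_t (\prod_i g i (D i t))%:E = \prod_i \int[P]_t (g i (D i t))%:E.
Proof.
move=> indep mg g0 gfin.
have mD i : measurable_fun setT (D i) by [].
(* The first [k] factors are arbitrary and the others are indicators. For [k = 0] this is
   independence itself, with the full index set for [J]. *)
suff : forall k (g : 'I_n -> diagram R -> R),
    (forall i, measurable_fun setT (g i)) ->
    (forall i x, (0 <= g i x)%R) ->
    (forall i, \int[P]_t (g i (D i t))%:E < +oo) ->
    (forall i : 'I_n, (k <= i)%N -> exists2 S, measurable S & g i = \1_S) ->
    \int[P]_t (\prod_i g i (D i t))%:E = \prod_i \int[P]_t (g i (D i t))%:E.
  by move=> /(_ n); apply => // i; rewrite leqNgt ltn_ord.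
elim=> [|k IH] {mg g0 gfin} {}g mg g0 gfin gind.
  have /choice[S HS] : forall i, exists S, measurable S /\ g i = \1_S.
    by move=> i; have [//|S mS gS] := gind i; exists S.
  have HP := indep [set: 'I_n]%SET S (fun i => (HS i).1).
  transitivity (P (\bigcap_(i in [set i | i \in [set: 'I_n]%SET]) (D i @^-1` S i))).
    set B := \bigcap_(i in _) _.
    have mB : measurable B.
      apply: fin_bigcap_measurable => // i _; rewrite -[X in measurable X]setTI.
      by apply: mD => //; exact: (HS i).1.
    rewrite -[X in P X]setIT -integral_indic//.
    apply: eq_integral => t _; congr EFin; rewrite indicE.
    have [tS|tS] := boolP (t \in _).
      rewrite big1//= => i _; rewrite (HS i).2 indicE.
      rewrite mem_set//; move/set_mem: tS => /(_ i); apply.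
      by rewrite /= inE.
    have [i iS] : exists i, ~ S i (D i t).
      apply/existsNP => H; move/negP: tS; apply; apply/mem_set => i _; exact: H.
    by rewrite (bigD1 i)//= (HS i).2 indicE memNset// mul0r.
  rewrite HP; apply: eq_big => [i|i _]; first by rewrite inE.
  rewrite (HS i).2 -[X in P X]setIT -integral_indic//.
  by rewrite -[X in measurable X]setTI; apply: mD => //; exact: (HS i).1.
have [kn|nk] := ltnP k n; last first.
  apply: IH => // i ki; apply: gind; rewrite ltn_neqAle ki andbT.
  by apply/eqP => ki'; move: (ltn_ord i); rewrite -ki' ltnNge nk.
(* The factor of index [k] is the one to be freed: the induction hypothesis gives the product rule
   with any indicator in its place. *)
pose i0 := Ordinal kn.
have mX : measurable_fun setT (fun t => (\prod_(i | i != i0) g i (D i t))%:E).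
  apply/measurable_EFinP; under eq_fun do rewrite big_mkcond/=.
  apply: (@measurable_prod _ _ _ _ _ (index_enum 'I_n)
    (fun i t => if i != i0 then g i (D i t) else 1%R)) => i _.
  by case: (i != i0) => //; exact: measurableT_comp.
have fin i : \int[P]_t (g i (D i t))%:E \is a fin_num.
  by rewrite ge0_fin_numE// integral_ge0// => t _; rewrite lee_fin.
transitivity (\int[P]_t ((\prod_(i | i != i0) g i (D i t))%:E *
    (g i0 (D i0 t))%:E)).
  by apply: eq_integral => t _; rewrite (bigD1 i0)//= mulrC EFinM.
rewrite [RHS](bigD1 i0)//= muleC.
apply: (@indicator_product_ext _ _ _ _ _ _ _ _ _ (fun x => (g i0 x)%:E)).
- exact: mX.
- by move=> t; rewrite lee_fin prodr_ge0.
- exact: mD.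
- by rewrite prode_fin_num.
- by apply: prode_ge0 => i _; apply: integral_ge0 => t _; rewrite lee_fin.
- by [].
- move=> S mS.
  pose g' i := if i == i0 then \1_S else g i.
  have m1S : measurable_fun setT (\1_S : diagram R -> R).
    exact: measurable_indic.
  have := IH g'; rewrite /g' => {}IH.
  transitivity (\int[P]_t (\prod_i g' i (D i t))%:E).
    apply: eq_integral => t _; rewrite [in RHS](bigD1 i0)//= /g' eqxx mulrC EFinM.
    congr (_%:E * _); apply: eq_bigr => i /negbTE ->//.
  rewrite IH; first last.
  + move=> i ki; case: eqP => [_|/eqP ii0]; first by exists S.
    apply: gind; rewrite ltn_neqAle ki andbT; apply: contra ii0 => /eqP ki'.
    by apply/eqP/val_inj.
  + move=> i; case: eqP => // _; apply: (@le_lt_trans _ _ (\int[P]_t 1)).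
      apply: ge0_le_integral => //.
      * by apply/measurable_EFinP; exact: measurableT_comp.
      * by move=> t _; rewrite lee_fin indicE; case: (_ \in _).
    by rewrite integral_cst//= mul1e probability_setT ltry.
  + by move=> i x; case: eqP => // _; rewrite indicE.
  + by move=> i; case: eqP.
  rewrite [LHS](bigD1 i0)//= eqxx muleC; congr (_ * _).
  by apply: eq_bigr => i /negbTE ->.
- by apply/measurable_EFinP.
- by move=> x; rewrite lee_fin.
Qed.

End IndependentProduct.

(** * Exponential moments of bounded variables *)

Lemma expR_sub1_le (R : realType) (x : R) : expR x - 1 <= x * expR x.
Proof.
have := expR_ge1Dx (- x); rewrite -(ler_pM2r (expR_gt0 x)) expRN.
by rewrite mulVf ?gt_eqF ?expR_gt0//; lra.
Qed.

(** By the previous lemma [e^x - 1 - x <= x (e^x - 1)]. For [x >= 0] that lemma bounds the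
    right-hand side by [x^2 e^x]; for [x < 0] the inequality [e^x - 1 >= x] bounds it by [x^2]. *)
Lemma expR_le_quadratic (R : realType) (x b : R) : `|x| <= b ->
  expR x <= 1 + x + expR b * x ^+ 2.
Proof.
move=> xb.
have h1 := expR_sub1_le x.
have h2 : x * (expR x - 1) <= expR b * x ^+ 2.
  have [x0|x0] := leP 0 x.
    have eb : expR x <= expR b by rewrite ler_expR (le_trans _ xb)// ler_norm.
    apply: (@le_trans _ _ (x * (x * expR x))); first exact: ler_wpM2l.
    by rewrite mulrA -expr2 mulrC ler_wpM2r// sqr_ge0.
  have b1 : 1 <= expR b by rewrite -expR0 ler_expR (le_trans _ xb).
  apply: (@le_trans _ _ (x ^+ 2)).
    by rewrite expr2; apply: ler_wnM2l; [exact: ltW|have := expR_ge1Dx x; lra].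
  by rewrite ler_peMl// sqr_ge0.
by lra.
Qed.

Definition coshR {R : realType} (x : R) : R := (expR x + expR (- x)) / 2.

Lemma measurable_coshR (R : realType) : measurable_fun setT (@coshR R).
Proof.
apply: measurable_funM => //; apply: measurable_funD => //.
by apply: measurableT_comp => //; exact: measurable_oppr.
Qed.

Lemma coshR_ge1 (R : realType) (x : R) : 1 <= coshR x.
Proof.
rewrite /coshR; have := expR_ge1Dx x; have := expR_ge1Dx (- x).
by lra.
Qed.

(** Both signs are covered by [e^|x| <= 2 cosh x]. *)
Lemma le_ln_coshR (R : realType) (x c : R) :
  0 <= c -> coshR x - 1 <= c -> `|x| <= ln (2 * (1 + c)).
Proof.
move=> c0 xc; rewrite -ler_expR lnK ?posrE; last by rewrite mulr_gt0//; lra.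
have [x0|x0] := leP 0 x.
  rewrite ger0_norm//; move: xc; rewrite /coshR; have := expR_gt0 (- x); lra.
rewrite ltr0_norm//; move: xc; rewrite /coshR; have := expR_gt0 x; lra.
Qed.

Section BoundedRandomVariables.
Context {R : realType} {d : measure_display} {T : measurableType d}.
Context (P : probability T R).

Lemma ae_bounded_integrable (f : T -> R) (b : R) : measurable_fun setT f ->
  {ae P, forall t, `|f t| <= b} -> P.-integrable setT (EFin \o f).
Proof.
move=> mf fb; apply/integrableP; split; first exact/measurable_EFinP.
apply: (@le_lt_trans _ _ (\int[P]_t `|b|%:E)%E).
  apply: ae_ge0_le_integral => //.
  - by apply: measurableT_comp => //; exact/measurable_EFinP.
  - apply: filterS fb => t tb _ /=; rewrite lee_fin (le_trans tb)//.
    exact: ler_norm.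
by rewrite integral_cst//= probability_setT mule1 ltry.
Qed.

(** The quadratic bound integrates to [1 + e + e^b s <= exp (e + e^b s)], and centring cancels [e].
    Only the second moment is left in the exponent, which later makes it proportional to the mean
    mass of a box. *)
Lemma mgf_centered_le (f : T -> R) (b : R) : measurable_fun setT f ->
  {ae P, forall t, `|f t| <= b} ->
  (\int[P]_t (expR (f t - \int[P]_u f u))%:E <=
   (expR (expR b * \int[P]_t (f t ^+ 2)))%:E)%E.
Proof.
move=> mf fb; set e := \int[P]_u f u; set s := \int[P]_t (f t ^+ 2).
have intf := ae_bounded_integrable mf fb.
have mf2 : measurable_fun setT (fun t => f t ^+ 2).
  exact: measurable_funX.
have intf2 : P.-integrable setT (fun t => (f t ^+ 2)%:E).
  apply: (@ae_bounded_integrable _ (b ^+ 2)) => //.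
  by apply: filterS fb => t tb /=; rewrite normrX lerXn2r ?nnegrE// (le_trans _ tb).
have fE : (\int[P]_t (f t)%:E = e%:E)%E.
  by rewrite fineK//; exact: integrable_fin_num.
have f2E : (\int[P]_t (f t ^+ 2)%:E = s%:E)%E.
  by rewrite fineK//; exact: integrable_fin_num.
pose q t := 1 + f t + expR b * f t ^+ 2.
have mq : measurable_fun setT q.
  apply: measurable_funD; first exact: measurable_funD.
  exact: measurable_funM.
have intq : (\int[P]_t (q t)%:E = (1 + e + expR b * s)%:E)%E.
  under eq_integral do rewrite 2!EFinD EFinM.
  rewrite integralD//=; last 2 first.
    apply: integrableD => //; exact: finite_measure_integrable_cst.
    exact: integrableZl.
  rewrite integralD//=; last exact: finite_measure_integrable_cst.
  by rewrite integral_cst//= probability_setT mule1 fE integralZl// f2E.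
have h1 : (\int[P]_t (expR (f t))%:E <= (1 + e + expR b * s)%:E)%E.
  (* The bound [q >= exp f >= 0] is at hand almost everywhere only, while monotonicity asks for an
     integrand that is nonnegative everywhere; hence the detour through the absolute value. *)
  have h2 : (\int[P]_t (`|q t|%:E) = \int[P]_t (q t)%:E)%E.
    apply: ae_eq_integral => //.
    - by apply/measurable_EFinP; exact: measurableT_comp.
    - exact/measurable_EFinP.
    - apply: filterS fb => t tb _ /=; rewrite ger0_norm//.
      exact: le_trans (expR_ge0 _) (expR_le_quadratic tb).
  rewrite -intq -h2; apply: ae_ge0_le_integral => //.
  - by apply/measurable_EFinP; exact: measurableT_comp.
  - by apply/measurable_EFinP; exact: measurableT_comp.
  - apply: filterS fb => t tb _ /=; rewrite lee_fin (le_trans _ (ler_norm _))//.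
    exact: expR_le_quadratic.
under eq_integral do rewrite expRD EFinM.
rewrite ge0_integralZr//; last first.
  by apply/measurable_EFinP; exact: measurableT_comp.
apply: (@le_trans _ _ ((1 + e + expR b * s)%:E * (expR (- e))%:E)%E).
  by apply: lee_wpmul2r => //; rewrite lee_fin expR_ge0.
rewrite -EFinM lee_fin expRN ler_pdivrMr ?expR_gt0// -expRD.
by rewrite addrC (le_trans _ (expR_ge1Dx _))//; lra.
Qed.

Lemma mgf_sum_le n (D : 'I_n -> {RV P >-> diagram R})
    (xi : 'I_n -> diagram R -> R) (b : R) : mutually_independent D ->
  (forall i, measurable_fun setT (xi i)) ->
  (forall i, {ae P, forall t, `|xi i (D i t)| <= b}) ->
  (\int[P]_t (expR (\sum_i (xi i (D i t) - \int[P]_u xi i (D i u))))%:E <=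
   (expR (expR b * \sum_i \int[P]_t (xi i (D i t) ^+ 2)))%:E)%E.
Proof.
move=> indep mxi xib.
have mxiD i : measurable_fun setT (fun t => xi i (D i t)).
  exact: measurableT_comp.
pose g i x := expR (xi i x - \int[P]_u xi i (D i u)).
have gle i := mgf_centered_le (mxiD i) (xib i).
under eq_integral do rewrite expR_sum.
rewrite (expectation_indep_prod (g := g))//; first last.
- by move=> i; rewrite (le_lt_trans (gle i))// ltry.
- by move=> i x; exact: expR_ge0.
- by move=> i; apply: measurableT_comp => //; exact: measurable_funB.
rewrite mulr_sumr expR_sum -prodEFin.
suff /andP[] : (0 <= \prod_i \int[P]_t (g i (D i t))%:E <=
    \prod_i (expR (expR b * \int[P]_t (xi i (D i t) ^+ 2)))%:E)%E by [].
elim/big_rec2 : _ => [|i x y _ /andP[x0 xy]]; first by rewrite lee01 lexx.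
have g0 : (0 <= \int[P]_t (g i (D i t))%:E)%E.
  by apply: integral_ge0 => t _; rewrite lee_fin expR_ge0.
by rewrite mule_ge0//=; apply: lee_pmul => //; exact: gle.
Qed.

(** The bounds for the sum and for its opposite average to [E cosh <= e^y] with [y = e^b s]. Then
    [e^y - 1 <= y e^y] keeps a factor [s] outside the exponential, so the bound can be summed over
    any number of cells. *)
Lemma cosh_sum_le n (D : 'I_n -> {RV P >-> diagram R})
    (xi : 'I_n -> diagram R -> R) (b s : R) : mutually_independent D ->
  (forall i, measurable_fun setT (xi i)) ->
  (forall i, {ae P, forall t, `|xi i (D i t)| <= b}) ->
  \sum_i \int[P]_t (xi i (D i t) ^+ 2) <= s ->
  (\int[P]_t (coshR (\sum_i (xi i (D i t) - \int[P]_u xi i (D i u))) - 1)%:E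
   <= (expR b * s * expR (expR b * s))%:E)%E.
Proof.
move=> indep mxi xib sums.
have mY (y : 'I_n -> diagram R -> R) : (forall i, measurable_fun setT (y i)) ->
    measurable_fun setT (fun t => \sum_i (y i (D i t) - \int[P]_u y i (D i u))).
  move=> my; apply: measurable_sum => i; apply: measurable_funB => //.
  exact: measurableT_comp.
pose Y t := \sum_i (xi i (D i t) - \int[P]_u xi i (D i u)).
have E1 : (\int[P]_t (expR (Y t))%:E <= (expR (expR b * s))%:E)%E.
  apply: (le_trans (mgf_sum_le indep mxi xib)).
  by rewrite lee_fin ler_expR ler_wpM2l// expR_ge0.
have E2 : (\int[P]_t (expR (- Y t))%:E <= (expR (expR b * s))%:E)%E.
  have mxi' i : measurable_fun setT (fun x => - xi i x).
    exact: measurableT_comp.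
  have xib' i : {ae P, forall t, `|- xi i (D i t)| <= b}.
    by apply: filterS (xib i) => t; rewrite normrN.
  have -> : (\int[P]_t (expR (- Y t))%:E = \int[P]_t (expR (\sum_i
      (- xi i (D i t) - \int[P]_u (- xi i (D i u)))))%:E)%E.
    apply: eq_integral => t _; rewrite /Y -sumrN; congr (expR _)%:E.
    apply: eq_bigr => i _; rewrite opprB addrC; congr (_ + _).
    rewrite -[RHS]mulN1r -RintegralZl//; last first.
      apply: (ae_bounded_integrable _ (xib' i)).
      exact: (measurableT_comp (mxi' i)).
    by apply: eq_Rintegral => u _; rewrite mulrNN mul1r.
  apply: (le_trans (mgf_sum_le indep mxi' xib')).
  rewrite lee_fin ler_expR ler_wpM2l ?expR_ge0//.
  by under eq_bigr do under eq_Rintegral do rewrite sqrrN.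
have mYt : measurable_fun setT Y by exact: mY.
have mE1 : measurable_fun setT (fun t => expR (Y t)) by exact: measurableT_comp.
have mE2 : measurable_fun setT (fun t => expR (- Y t)).
  by apply: measurableT_comp => //; exact: measurableT_comp.
have E3 : (\int[P]_t (coshR (Y t) - 1)%:E + 1 <= (expR (expR b * s))%:E)%E.
  have -> : (\int[P]_t (coshR (Y t) - 1)%:E + 1 = \int[P]_t (coshR (Y t))%:E)%E.
    rewrite -[X in (_ + X)%E](_ : \int[P]_t 1%:E = 1)%E; last first.
      by rewrite integral_cst//= probability_setT mule1.
    rewrite -ge0_integralD//.
    - by apply: eq_integral => t _; rewrite -EFinD subrK.
    - by move=> t _; rewrite lee_fin subr_ge0 coshR_ge1.
    - apply/measurable_EFinP; apply: measurable_funB => //.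
      exact: measurableT_comp (@measurable_coshR R) _.
  under eq_integral do rewrite /coshR mulrC EFinM EFinD.
  rewrite ge0_integralZl_EFin//; last 2 first.
  - by move=> t _; rewrite adde_ge0// lee_fin expR_ge0.
  - by apply: emeasurable_funD; exact/measurable_EFinP.
  rewrite ge0_integralD//.
  apply: (@le_trans _ _ (2^-1%:E * (expR (expR b * s) + expR (expR b * s))%:E)%E).
    by apply: lee_wpmul2l; rewrite ?lee_fin// EFinD leeD.
    by rewrite -EFinM lee_fin; lra.
  - exact/measurable_EFinP.
  - exact/measurable_EFinP.
rewrite -leeBrDr// in E3; apply: (le_trans E3).
by rewrite -EFinB lee_fin expR_sub1_le.
Qed.

End BoundedRandomVariables.

(** * Dyadic chaining in a cell *)

(** Two such indices differ by at most [2 k], so subtracting the least one is an injection into the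
    first [2 k + 1] integers. *)
Lemma card_near_le (R : realType) (m k : nat) (y : R) :
  (#|[set j : 'I_m | (`|y - j%:R| <= k%:R)%R]%SET| <= k.*2.+1)%N.
Proof.
set A := [set j : 'I_m | _]%SET.
have [->|[j0 j0A]] := set_0Vmem A; first by rewrite cards0.
have [j1 j1A jmin] := @arg_minnP _ j0 (mem A) (@nat_of_ord m) j0A.
have lt_j (j : 'I_m) : j \in A -> (j - j1 < k.*2.+1)%N.
  move=> jA; have := jA; have := j1A; rewrite !inE !ler_distl => /andP[h1 h2] /andP[h3 h4].
  rewrite ltnS leq_subLR -(ler_nat R) -addnn !natrD; lra.
pose f (j : 'I_m) : 'I_k.*2.+1 := inord (j - j1).
rewrite -[X in (_ <= X)%N]card_ord -(card_in_imset (f := f)) ?max_card//.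
move=> i j iA jA /(congr1 (@nat_of_ord _)).
rewrite /f !inordK ?lt_j// => ij; apply/val_inj => /=.
by rewrite -(subnK (jmin _ iA)) ij subnK// jmin.
Qed.

(** This makes halving an index the passage to the parent in the dyadic tree. *)
Lemma truncn_double (R : realType) (x : R) : 0 <= x ->
  ((Num.truncn (2 * x))./2 = Num.truncn x)%N.
Proof.
move=> x0; set z := Num.truncn (2 * x).
have /andP[z1 z2] : z%:R <= 2 * x < z.+1%:R by rewrite truncn_itv// mulr_ge0.
apply/esym/eqP; rewrite truncn_eq//.
have zE : z%:R = (odd z)%:R + 2 * z./2%:R :> R.
  by rewrite -[in LHS](odd_double_half z) natrD -muln2 natrM mulrC.
have z2' : 2 * x < z%:R + 1 by rewrite natr1.
have -> : z./2.+1%:R = z./2%:R + 1 :> R by rewrite natr1.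
by move: z1 z2'; rewrite zE; case: (odd z); rewrite /= ?mulr1n ?mulr0n; lra.
Qed.

Section Chaining.
Context {R : realType}.
Variable a : R.
Hypothesis a_gt0 : 0 < a.

Definition dyadic_pt (j : nat * nat) (k : nat) (z : nat * nat) : plane R :=
  (a * (j.1%:R + z.1%:R / 2 ^+ k), a * (j.2%:R + z.2%:R / 2 ^+ k)).

(** At level 0 the increment is the value at the corner of the cell, so the increments along a
    branch telescope to a value of [f] and not to a difference. *)
Definition dyadic_inc (f : plane R -> R) j k (z : nat * nat) : R :=
  f (dyadic_pt j k z) -
  (if k is k'.+1 then f (dyadic_pt j k' (z.1./2, z.2./2)) else 0).

Definition in_cell (j : nat * nat) (w : plane R) : Prop :=
  (j.1%:R * a <= w.1 <= j.1.+1%:R * a) /\ (j.2%:R * a <= w.2 <= j.2.+1%:R * a).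

Definition cell_of (w : plane R) : nat * nat :=
  (Num.truncn (w.1 / a), Num.truncn (w.2 / a)).

Definition dyadic_idx (w : plane R) (k : nat) : nat * nat :=
  (Num.truncn (2 ^+ k * (w.1 / a - (cell_of w).1%:R)),
   Num.truncn (2 ^+ k * (w.2 / a - (cell_of w).2%:R))).

Lemma truncn_frac (x : R) : 0 <= x -> 0 <= x - (Num.truncn x)%:R < 1.
Proof.
move=> x0; have /andP[h1 h2] := truncn_itv x0.
by rewrite subr_ge0 h1 ltrBlDl natr1.
Qed.

Lemma in_cell_of (w : plane R) : 0 <= w.1 -> 0 <= w.2 -> in_cell (cell_of w) w.
Proof.
move=> w1 w2; split => /=.
  have /andP[h1 h2] := truncn_itv (divr_ge0 w1 (ltW a_gt0)).
  by rewrite -ler_pdivlMr// h1 -ler_pdivrMr// ltW.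
have /andP[h1 h2] := truncn_itv (divr_ge0 w2 (ltW a_gt0)).
by rewrite -ler_pdivlMr// h1 -ler_pdivrMr// ltW.
Qed.

Lemma dyadic_idx_lt (w : plane R) k : 0 <= w.1 -> 0 <= w.2 ->
  ((dyadic_idx w k).1 < 2 ^ k)%N /\ ((dyadic_idx w k).2 < 2 ^ k)%N.
Proof.
move=> w1 w2; split => /=; rewrite -(ltr_nat R) natrX.
  have /andP[h1 h2] := truncn_frac (divr_ge0 w1 (ltW a_gt0)).
  apply: (@le_lt_trans _ _ (2 ^+ k * (w.1 / a - (Num.truncn (w.1 / a))%:R))).
    by rewrite truncn_le// mulr_ge0// exprn_ge0.
  by rewrite gtr_pMr// exprn_gt0.
have /andP[h1 h2] := truncn_frac (divr_ge0 w2 (ltW a_gt0)).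
apply: (@le_lt_trans _ _ (2 ^+ k * (w.2 / a - (Num.truncn (w.2 / a))%:R))).
  by rewrite truncn_le// mulr_ge0// exprn_ge0.
by rewrite gtr_pMr// exprn_gt0.
Qed.

Lemma dyadic_idx_half (w : plane R) k : 0 <= w.1 -> 0 <= w.2 ->
  ((dyadic_idx w k.+1).1./2, (dyadic_idx w k.+1).2./2) = dyadic_idx w k.
Proof.
move=> w1 w2; rewrite /dyadic_idx/= !exprS -!mulrA !truncn_double//.
  have /andP[h1 _] := truncn_frac (divr_ge0 w2 (ltW a_gt0)).
  by rewrite mulr_ge0// exprn_ge0.
have /andP[h1 _] := truncn_frac (divr_ge0 w1 (ltW a_gt0)).
by rewrite mulr_ge0// exprn_ge0.
Qed.

Lemma dyadic_pt_in_cell j k z : (z.1 < 2 ^ k)%N -> (z.2 < 2 ^ k)%N ->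
  in_cell j (dyadic_pt j k z).
Proof.
have H i (y : nat) : (y < 2 ^ k)%N ->
    i%:R * a <= a * (i%:R + y%:R / 2 ^+ k) <= i.+1%:R * a.
  move=> yk; rewrite ![_ * a]mulrC !ler_pM2l// lerDl divr_ge0//=.
  have -> : i.+1%:R = i%:R + 1 :> R by rewrite natr1.
  by rewrite lerD2l ler_pdivrMr ?exprn_gt0// mul1r -natrX ler_nat ltnW.
by move=> z1 z2; split; exact: H.
Qed.

(** Each coordinate of a child exceeds that of its parent by [a / 2^(k+1)] times the last binary
    digit of its index. *)
Lemma dyadic_pt_parent j k (z : nat * nat) :
  `|(dyadic_pt j k.+1 z).1 - (dyadic_pt j k (z.1./2, z.2./2)).1| <= a / 2 ^+ k.+1 /\
  `|(dyadic_pt j k.+1 z).2 - (dyadic_pt j k (z.1./2, z.2./2)).2| <= a / 2 ^+ k.+1.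
Proof.
have H i (y : nat) : `|a * (i%:R + y%:R / 2 ^+ k.+1) -
    a * (i%:R + y./2%:R / 2 ^+ k)| <= a / 2 ^+ k.+1.
  have -> : a * (i%:R + y%:R / 2 ^+ k.+1) - a * (i%:R + y./2%:R / 2 ^+ k) =
      a / 2 ^+ k.+1 * (y%:R - 2 * y./2%:R).
    by rewrite exprS; field; rewrite expf_neq0.
  have -> : y%:R - 2 * y./2%:R = (odd y)%:R :> R.
    have yE : y%:R = (odd y)%:R + 2 * y./2%:R :> R.
      by rewrite -[in LHS](odd_double_half y) natrD -muln2 natrM mulrC.
    by rewrite yE; ring.
  rewrite normrM ger0_norm ?ler_piMr// ?divr_ge0 ?exprn_ge0 ?(ltW a_gt0)//.
  by case: (odd y); rewrite ?normr1 ?normr0.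
by split; exact: H.
Qed.

Lemma dyadic_pt_idx (w : plane R) k : 0 <= w.1 -> 0 <= w.2 ->
  `|w.1 - (dyadic_pt (cell_of w) k (dyadic_idx w k)).1| <= a / 2 ^+ k /\
  `|w.2 - (dyadic_pt (cell_of w) k (dyadic_idx w k)).2| <= a / 2 ^+ k.
Proof.
have H (x : R) : 0 <= x -> `|x - a * ((Num.truncn (x / a))%:R +
    (Num.truncn (2 ^+ k * (x / a - (Num.truncn (x / a))%:R)))%:R / 2 ^+ k)| <= a / 2 ^+ k.
  move=> x0; set j : R := (Num.truncn (x / a))%:R.
  have /andP[h1 h2] := truncn_frac (divr_ge0 x0 (ltW a_gt0)).
  set y := 2 ^+ k * (x / a - j).
  have y0 : 0 <= y by rewrite mulr_ge0// exprn_ge0.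
  have -> : x - a * (j + (Num.truncn y)%:R / 2 ^+ k) =
      a / 2 ^+ k * (y - (Num.truncn y)%:R).
    by rewrite /y; field; rewrite expf_neq0//= gt_eqF.
  have /andP[h3 h4] := truncn_frac y0.
  rewrite normrM !ger0_norm// ?ler_piMr// ?divr_ge0 ?exprn_ge0 ?(ltW a_gt0)//.
  exact: ltW.
by move=> w1 w2; split; exact: H.
Qed.

(** By [dyadic_idx_half] the indices of [w] form a branch of the dyadic tree, along which the
    increments telescope. *)
Lemma chaining_le (f : plane R -> R) (w : plane R) (B : nat -> R) k :
  0 <= w.1 -> 0 <= w.2 ->
  (forall l (z : nat * nat), (l <= k)%N -> (z.1 < 2 ^ l)%N -> (z.2 < 2 ^ l)%N ->
    `|dyadic_inc f (cell_of w) l z| <= B l) ->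
  `|f (dyadic_pt (cell_of w) k (dyadic_idx w k))| <= \sum_(l < k.+1) B l.
Proof.
move=> w1 w2; elim: k => [|k IH] HB.
  have [i1 i2] := dyadic_idx_lt 0 w1 w2.
  have := HB 0%N _ (leqnn _) i1 i2; rewrite /dyadic_inc subr0 big_ord1.
  by apply.
rewrite big_ord_recr/=; have [i1 i2] := dyadic_idx_lt k.+1 w1 w2.
have := HB k.+1 _ (leqnn _) i1 i2; rewrite /dyadic_inc dyadic_idx_half// => h.
have {}IH := IH (fun l z lk => HB l z (leqW lk)).
set u := f _ in h *; set v := f _ in h IH.
by rewrite -[u](subrK v) addrC (le_trans (ler_normD _ _))// lerD.
Qed.

Lemma geometric_affine_sum_le (al be : R) m : 0 <= al -> 0 <= be ->
  \sum_(k < m) (3 / 4) ^+ k * (al * k%:R + be) <= 4 * be + 12 * al.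
Proof.
move=> al0 be0.
(* For [x = 3/4] the full series of [x^k] and [k x^k] have sums 4 and 12; the subtracted term is the
   tail from [m] on. *)
have -> : \sum_(k < m) (3 / 4) ^+ k * (al * k%:R + be) =
    4 * be + 12 * al - (3 / 4) ^+ m * (4 * (al * m%:R + be + 3 * al)).
  elim: m => [|m IH]; first by rewrite big_ord0 expr0; ring.
  by rewrite big_ord_recr/= IH exprS -natr1; field.
rewrite gerBl mulr_ge0// ?exprn_ge0//.
by rewrite !mulr_ge0 ?addr_ge0 ?mulr_ge0.
Qed.

End Chaining.

(** * Geometry of the domain *)

(** The infimum is attained at the orthogonal projection, which stays on the segment because both
    coordinates of [x] lie in [[0, L]]. The lower bound is [(v - u)^2 <= 2 (u^2 + v^2)]. *)
Lemma dist_diag_Omega (R : realType) (L : R) (x : plane R) : Omega L x ->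
  dist_diag L x = (x.2 - x.1) / Num.sqrt 2.
Proof.
move=> [x1 [x12 x2]].
have s2 : 0 < Num.sqrt (2 : R) by rewrite sqrtr_gt0.
have s22 : Num.sqrt 2 ^+ 2 = 2 :> R by rewrite sqr_sqrtr.
have u0 : 0 <= (x.2 - x.1) / Num.sqrt 2 by rewrite divr_ge0 ?sqrtr_ge0//; lra.
have u2 : ((x.2 - x.1) / Num.sqrt 2) ^+ 2 = (x.2 - x.1) ^+ 2 / 2.
  by rewrite exprMn exprVn s22.
apply/eqP; rewrite eq_le; apply/andP; split.
  apply: ge_inf; first by exists 0 => _ [y _ <-]; exact: sqrtr_ge0.
  exists ((x.1 + x.2) / 2, (x.1 + x.2) / 2); first by split => //=; lra.
  rewrite /enorm/= -[RHS](ger0_norm u0) -sqrtr_sqr u2; congr Num.sqrt.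
  by field.
apply: lb_le_inf.
  by exists (enorm (x - (0, 0))); exists (0, 0) => //; split => //=; lra.
move=> _ [y [_ y12] <-]; rewrite /enorm/= -[X in X <= _](ger0_norm u0) -sqrtr_sqr u2.
rewrite ler_wsqrtr// y12; set u := x.1 - y.1; set v := x.2 - y.1.
have -> : x.2 - x.1 = v - u by rewrite /u /v; ring.
by have := sqr_ge0 (u + v); rewrite !expr2; lra.
Qed.

(** * Point measures *)

Section FinitePointMeasures.
Context {R : realType}.

Lemma pers_measureE (D : seq (plane R)) (A : set (plane R)) :
  pers_measure D A = (\sum_(k < size D) \1_A (nth 0 D k))%:E.
Proof. by rewrite /pers_measure/= /msum -sumEFin. Qed.

Lemma pers_measureT (D : seq (plane R)) : pers_measure D setT = (size D)%:R%:E.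
Proof.
rewrite pers_measureE; under eq_bigr do rewrite indicT.
by rewrite sumr_const card_ord.
Qed.

Lemma pers_measure_finite (D : seq (plane R)) : (pers_measure D setT < +oo)%E.
Proof. by rewrite pers_measureT ltry. Qed.

Lemma npers_measureE (D : seq (plane R)) (A : set (plane R)) :
  npers_measure D A = ((size D)%:R^-1%:E * pers_measure D A)%E.
Proof. by []. Qed.

Lemma npers_measureT_le1 (D : seq (plane R)) : (npers_measure D setT <= 1)%E.
Proof.
rewrite npers_measureE pers_measureT -EFinM lee_fin.
have [->|D0] := eqVneq ((size D)%:R : R) 0; first by rewrite mulr0.
by rewrite mulVf.
Qed.

Lemma npers_measure_finite (D : seq (plane R)) : (npers_measure D setT < +oo)%E.
Proof. by rewrite (le_lt_trans (npers_measureT_le1 D))// ltry. Qed.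

Lemma measurable_pers_measure (A : set (plane R)) : measurable A ->
  measurable_fun setT (fun D : diagram R => pers_measure D A).
Proof.
move=> mA _ B mB; rewrite setTI; apply: sub_gen_smallest.
by exists A => //; exists B.
Qed.

(** The size is the total mass, hence visible to the sigma-algebra; as it takes countably many
    values, every preimage is a countable union of generators. *)
Lemma measurable_diagram_size (g : nat -> R) :
  measurable_fun setT (fun D : diagram R => g (size D)).
Proof.
move=> _ B mB; rewrite setTI.
have -> : (fun D : diagram R => g (size D)) @^-1` B = \bigcup_(k in [set k | B (g k)])
    [set D : diagram R | [set k%:R%:E] (pers_measure D setT)].
  apply/seteqP; split => [D /= BD|D [k /= Bk]].
    by exists (size D) => //=; rewrite pers_measureT.
  by rewrite pers_measureT => -[] /eqP; rewrite eqr_nat => /eqP ->.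
apply: bigcup_measurable => k _; apply: sub_gen_smallest.
by exists setT => //; exists [set k%:R%:E] => //; exact: emeasurable_set1.
Qed.

Lemma measurable_npers_measure (A : set (plane R)) : measurable A ->
  measurable_fun setT (fun D : diagram R => npers_measure D A).
Proof.
move=> mA; apply: emeasurable_funM; last exact: measurable_pers_measure.
apply/measurable_EFinP.
exact: (measurable_diagram_size (fun k => k%:R^-1)).
Qed.

End FinitePointMeasures.

Section RandomFiniteMeasure.
Context {R : realType} {d d' : measure_display}.
Context {X : measurableType d} {Y : measurableType d'}.
Variable nu : X -> {measure set Y -> \bar R}.
Hypothesis mnu : forall A, measurable A -> measurable_fun setT (nu ^~ A).
Hypothesis nufin : forall x, (nu x setT < +oo)%E.

Lemma bounded_integrable_finite x (U : set Y) (g : Y -> R) (C : R) :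
  measurable U -> measurable_fun U g -> (forall y, U y -> `|g y| <= C) ->
  (nu x).-integrable U (EFin \o g).
Proof.
move=> mU mg gC; apply/integrableP; split; first exact/measurable_EFinP.
apply: (@le_lt_trans _ _ (\int[nu x]_(y in U) `|C|%:E)%E).
  apply: ge0_le_integral => //.
  - by apply: measurableT_comp => //; exact/measurable_EFinP.
  - by move=> y Uy /=; rewrite lee_fin (le_trans (gC _ Uy))// ler_norm.
rewrite integral_cst//= lte_mul_pinfty// ?lee_fin//.
by apply: le_lt_trans (nufin x); apply: le_measure; rewrite ?inE.
Qed.

Lemma measurable_Rintegral_param (U : set Y) (g : Y -> R) :
  measurable U -> measurable_fun U g ->
  measurable_fun setT (fun x => \int[nu x]_(y in U) g y).
Proof.
move=> mU mg; apply: (measurableT_comp (fine_measurable _)) => //.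
under eq_fun do rewrite integral_mkcond integralE.
have mG : measurable_fun setT ((EFin \o g) \_ U).
  by apply/(measurable_restrictT _ mU)/measurable_EFinP.
apply: emeasurable_funB; apply: measurable_fun_integral_kernel => //.
  exact: measurable_funepos.
exact: measurable_funeneg.
Qed.

(** The indicator in the hypothesis says at once that [g] is bounded by [C] and that it vanishes off
    [A]. With [A] a box, this bounds kernel integrals by the mass of the box. *)
Lemma normr_Rintegral_le x (U A : set Y) (g : Y -> R) (C : R) :
  measurable U -> measurable A -> A `<=` U -> measurable_fun U g -> 0 <= C ->
  (forall y, U y -> `|g y| <= C * \1_A y) ->
  `|\int[nu x]_(y in U) g y| <= C * fine (nu x A).
Proof.
move=> mU mA AU mg C0 gC.
have gC' y : U y -> `|g y| <= C.
  move=> Uy; apply: le_trans (gC _ Uy) _; rewrite indicE.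
  by case: (_ \in _); rewrite ?mulr1 ?mulr0.
have ig := bounded_integrable_finite x mU mg gC'.
have m1A : measurable_fun U (fun y => C * \1_A y).
  by apply: measurable_funM => //; exact: measurable_indic.
apply: le_trans (le_normr_Rintegral mU ig) _.
have i1A : (nu x).-integrable U (EFin \o (fun y => C * \1_A y)).
  apply: (@bounded_integrable_finite x U _ C) => // y Uy.
  by rewrite indicE; case: (_ \in _); rewrite ?mulr1 ?mulr0 ?normr0 ?ger0_norm.
apply: (@le_trans _ _ (\int[nu x]_(y in U) (C * \1_A y))).
  apply: le_Rintegral => //.
  apply: (@bounded_integrable_finite x U _ C) => //.
    exact: measurableT_comp.
  by move=> y Uy; rewrite normr_id; exact: gC'.
rewrite RintegralZl//; last first.
  apply: (@bounded_integrable_finite x U _ 1) => // y Uy.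
  by rewrite indicE; case: (_ \in _); rewrite ?normr0 ?normr1.
by rewrite /Rintegral integral_indic//= (setIidl AU).
Qed.

End RandomFiniteMeasure.

(** * Duality *)

Section Duality.
Context {R : realType} {d : measure_display} {T : measurableType d}.
Context {d' : measure_display} {Y : measurableType d'}.
Context (P : probability T R) (m : {sigma_finite_measure set Y -> \bar R}).

(** After Fubini, the deviation is the integral of [g] times the weighted pointwise deviation, and
    [g] has integral at most [r]. The crude bound [c] only provides integrability. It is assumed at
    [t0] as well, since an almost sure bound says nothing about one given outcome. *)
Lemma deviation_duality (S : set Y) (f g w : Y -> R) (phat : T -> Y -> R)
    (c B r : R) (t0 : T) :
  measurable S -> measurable_fun S f -> measurable_fun S g ->
  measurable_fun setT (fun tx : T * Y => phat tx.1 tx.2) ->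
  (forall x, S x -> 0 < w x) -> (forall x, S x -> 0 <= g x) ->
  (forall x, S x -> f x = w x * g x) -> 0 <= B ->
  (\int[m]_(x in S) (g x)%:E <= r%:E)%E ->
  (forall x, S x -> {ae P, forall t, w x * `|phat t x| <= c}) ->
  (forall x, S x -> w x * `|phat t0 x| <= c) ->
  (forall x, S x -> w x * `|phat t0 x - \int[P]_t phat t x| <= B) ->
  (`|(\int[m]_(x in S) (f x * phat t0 x))%R%:E -
     'E_P[fun t => (\int[m]_(x in S) (f x * phat t x))%R]| <= (r * B)%:E)%E.
Proof.
move=> mS mf mg mphat w0 g0 fg B0 intr boundc boundt0 dev.
have mphat_t t : measurable_fun setT (phat t).
  exact: (measurableT_comp mphat (pair1_measurable t)).
have mphat_x x : measurable_fun setT (phat ^~ x).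
  exact: (measurableT_comp mphat (pair2_measurable x)).
have f0 x : S x -> 0 <= f x.
  by move=> Sx; rewrite fg// mulr_ge0 ?g0// ltW// w0.
have c0 x : S x -> 0 <= c.
  by move=> Sx; apply: le_trans (boundt0 _ Sx); rewrite mulr_ge0// ltW// w0.
have ig k : m.-integrable S (fun x => (k * g x)%:E).
  apply/integrableP; split; first by apply/measurable_EFinP; exact: measurable_funM.
  apply: (@le_lt_trans _ _ (`|k|%:E * \int[m]_(x in S) (g x)%:E)%E).
    rewrite -ge0_integralZl_EFin//.
    - apply: ge0_le_integral => //.
      + by apply: measurableT_comp => //; apply/measurable_EFinP; exact: measurable_funM.
      + by apply: emeasurable_funM => //; exact/measurable_EFinP.
      + by move=> x Sx; rewrite /= normrM (ger0_norm (g0 _ Sx)).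
    - exact/measurable_EFinP.
  by rewrite lte_mul_pinfty//; exact: le_lt_trans intr (ltry _).
(* Extension by 0 outside [S], so that Fubini applies on the whole product. *)
pose G (tx : T * Y) : \bar R := ((f \_ S) tx.2 * phat tx.1 tx.2)%:E.
have mG : measurable_fun setT G.
  apply/measurable_EFinP; apply: measurable_funM => //.
  apply: measurableT_comp; last exact: measurable_snd.
  exact/(measurable_restrictT _ mS).
have GS t x : S x -> G (t, x) = (f x * phat t x)%:E.
  by move=> Sx; rewrite /G patchE mem_set.
have GnS t x : ~ S x -> G (t, x) = 0%E.
  by move=> Sx; rewrite /G patchE memNset// mul0r.
have iG : (P \x m)%E.-integrable setT G.
  apply/integrable21ltyP => //.
  apply: (@le_lt_trans _ _ (\int[m]_(x in S) (c * g x)%:E)%E); last first.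
    have /integrableP[_] := ig c.
    rewrite (eq_integral (fun x => (c * g x)%:E))// => x /set_mem Sx.
    by rewrite gee0_abs// lee_fin mulr_ge0 ?g0 ?(c0 _ Sx).
  rewrite [leRHS]integral_mkcond; apply: ge0_le_integral => //.
  - by move=> x _; exact: integral_ge0.
  - apply: (measurable_fun_fubini_tonelli_G (m1 := P) (abse \o G)) => //.
      exact: measurableT_comp.
    by move=> x; exact: abse_ge0.
  - by apply/(measurable_restrictT _ mS)/measurable_EFinP; exact: measurable_funM.
  move=> x _; rewrite patchE; case: ifPn => [/set_mem Sx|/negP Sx].
    rewrite -[leRHS]mule1 -(probability_setT P) -[leRHS]integral_cst//.
    apply: ae_ge0_le_integral => //.
    - by apply: measurableT_comp => //; exact: (measurableT_comp mG (pair2_measurable x)).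
    - by move=> t _; rewrite lee_fin mulr_ge0 ?g0// (c0 _ Sx).
    - apply: filterS (boundc _ Sx) => t tc _; rewrite GS//= lee_fin normrM.
      rewrite (ger0_norm (f0 _ Sx)) (fg _ Sx) mulrAC ler_wpM2r// ?g0//.
  by rewrite integral0_eq// => t _; rewrite GnS ?abse0// => /mem_set.
pose e x := \int[P]_t phat t x.
have iphat x : S x -> P.-integrable setT (EFin \o phat ^~ x).
  move=> Sx; apply: (@ae_bounded_integrable _ _ _ _ _ ((w x)^-1 * c)) => //.
  by apply: filterS (boundc _ Sx) => t; rewrite ler_pdivlMl// w0.
have HE x : S x -> (\int[P]_t G (t, x) = (f x * e x)%:E)%E.
  move=> Sx; under eq_integral do rewrite GS// EFinM.
  rewrite integralZl//; last exact: iphat.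
  by rewrite EFinM /e /Rintegral fineK//; apply: integrable_fin_num => //; exact: iphat.
have intS t : (\int[m]_x G (t, x) = \int[m]_(x in S) (f x * phat t x)%:E)%E.
  rewrite [RHS]integral_mkcond; apply: eq_integral => x _; rewrite patchE.
  by case: ifPn => [/set_mem/GS//|/negP Sx]; apply: GnS => /mem_set.
have EPsi : ('E_P[fun t => (\int[m]_(x in S) (f x * phat t x))%R] =
    \int[m]_(x in S) (f x * e x)%:E)%E.
  rewrite unlock; transitivity (\int[P]_t \int[m]_x G (t, x))%E.
    (* The real integral is [fine] of an extended one; the two are known to agree only where the
       latter is finite, that is for almost every outcome. *)
    apply: ae_eq_integral => //.
    - apply/measurable_EFinP; apply: (measurableT_comp (fine_measurable _)) => //.
      under eq_fun do rewrite -intS.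
      exact: (measurable_fubini_F iG).
    - exact: (measurable_fubini_F iG).
    - have := ae_integrable1 iG; apply: filterS => t it _ /=.
      by rewrite intS /Rintegral fineK// -intS; exact: integrable_fin_num.
  rewrite (Fubini iG) [RHS]integral_mkcond; apply: eq_integral => x _.
  rewrite patchE; case: ifPn => [/set_mem/HE//|/negP Sx].
  by apply: integral0_eq => t _; apply: GnS => /mem_set.
have ife : m.-integrable S (fun x => (f x * e x)%:E).
  apply: (@eq_integrable _ _ _ m S mS (fun x => \int[P]_t G (t, x))%E).
    by move=> x /set_mem Sx; rewrite HE.
  apply: (@integrableS _ _ _ m setT S) => //; apply/integrableP; split.
    exact: (measurable_fubini_G iG).
  have intG : (\int[m]_y \int[P]_x `|G (x, y)| < +oo)%E.
    exact/integrable21ltyP.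
  apply: le_lt_trans intG.
  apply: ge0_le_integral => //.
  - by apply: measurableT_comp => //; exact: (measurable_fubini_G iG).
  - apply: (measurable_fun_fubini_tonelli_G (m1 := P) (abse \o G)) => //.
      exact: measurableT_comp.
    by move=> x; exact: abse_ge0.
  - move=> x _; apply: le_abse_integral => //.
    exact: (measurableT_comp mG (pair2_measurable x)).
have ift0 : m.-integrable S (fun x => (f x * phat t0 x)%:E).
  apply: (le_integrable mS _ _ (ig c)).
    apply/measurable_EFinP; apply: measurable_funM => //.
    exact: measurable_funTS.
  move=> x Sx; rewrite lee_fin normrM (ger0_norm (f0 _ Sx)) (fg _ Sx) mulrAC.
  by rewrite [leRHS]ger0_norm ?mulr_ge0 ?g0 ?(c0 _ Sx)// ler_wpM2r ?g0// boundt0.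
rewrite EPsi /Rintegral fineK; last exact: integrable_fin_num.
rewrite -integralB_EFin//.
apply: (@le_trans _ _ (\int[m]_(x in S) (B * g x)%:E)%E).
  apply: (le_trans (le_abse_integral _ _ _)) => //.
    by apply: measurable_int; exact: integrableB ift0 ife.
  apply: ge0_le_integral => //.
  - apply: measurableT_comp => //.
    by apply: measurable_int; exact: integrableB ift0 ife.
  - by apply/measurable_EFinP; exact: measurable_funM.
  - move=> x Sx /=; rewrite lee_fin -mulrBr normrM (ger0_norm (f0 _ Sx)) (fg _ Sx).
    by rewrite mulrAC ler_wpM2r ?g0// dev.
under eq_integral do rewrite EFinM.
rewrite ge0_integralZl_EFin//.
- by rewrite mulrC EFinM; apply: lee_wpmul2l.
- exact/measurable_EFinP.
Qed.

End Duality.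

(** * Uniform concentration *)

(** The mean of the dyadic sum is at most [b exp (g Lam)]. Chaining costs
    [4 ln (2 (1 + c)) + 12 ln 8 + 1], where the 1 is the truncation error; dividing by
    [ln (h0 ^- 2) <= Lam] turns the part independent of Lam into a multiple of Lam. *)
Definition conc_const {R : realType} (kappa M V ov h0 : R) : R :=
  let b := 2 * ov * expR (kappa * M) * kappa ^+ 2 * M ^+ 2 in
  let g := expR (kappa * M) * (kappa ^+ 2 * M * V) + 2 in
  4 * (g + 1) + (4 * ln (2 * (b + 2)) + 12 * ln 8 + 1) / ln (h0 ^- 2).

Section Concentration.
Context {R : realType} {d : measure_display} {T : measurableType d}.
Context (P : probability T R) (n : nat) (D : 'I_n -> {RV P >-> diagram R}).
Variables (a h kappa M V ov : R) (m : nat).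
(** In the application [F j w] is the kernel integral at [w] times the constant weight of the cell
    [j], [N j] is the weighted mass of the box of [j], and [ov] is the overlap number of the
    boxes. *)
Variables (F : nat * nat -> plane R -> diagram R -> R).
Variables (N : nat * nat -> diagram R -> R).
Hypothesis indep : mutually_independent D.
Hypothesis h_gt0 : 0 < h.
Hypothesis a_gt0 : 0 < a.
Hypothesis ah : 2 * a <= h.
Hypothesis kappa_ge0 : 0 <= kappa.
Hypothesis M_ge0 : 0 <= M.
Hypothesis ov_ge0 : 0 <= ov.
Hypothesis mF : forall j w, measurable_fun setT (F j w).
Hypothesis mN : forall j, measurable_fun setT (N j).
Hypothesis N_ge0 : forall j x, 0 <= N j x.
Hypothesis F_le : forall j w x, in_cell a j w -> `|F j w x| <= kappa * N j x.
Hypothesis F_lip : forall j v w x, in_cell a j v -> in_cell a j w ->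
  `|F j v x - F j w x| <= kappa * ((`|v.1 - w.1| + `|v.2 - w.2|) / h) * N j x.
Hypothesis N_le : {ae P, forall t, forall i j, N j (D i t) <= M}.
Hypothesis sumN_le : {ae P, forall t, forall i,
  \sum_(j : 'I_m * 'I_m) N (val j.1, val j.2) (D i t) <= ov * M}.
Hypothesis meanN_le : forall i j, \int[P]_t N j (D i t) <= V * h ^+ 2.

Let dev j w t := \sum_i (F j w (D i t) - \int[P]_u F j w (D i u)).
Let dinc j k z x := dyadic_inc a (F j ^~ x) j k z.
Let v j := \sum_i \int[P]_t N j (D i t).

Lemma measurable_comp_sample (g : diagram R -> R) i :
  measurable_fun setT g -> measurable_fun setT (fun t => g (D i t)).
Proof. by move=> mg; exact: measurableT_comp. Qed.

Lemma integrable_count i j : P.-integrable setT (fun t => (N j (D i t))%:E).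
Proof.
apply: (@ae_bounded_integrable _ _ _ _ _ M); first exact: measurable_comp_sample.
by apply: filterS N_le => t tM; rewrite ger0_norm.
Qed.

Lemma integrable_F i j w : in_cell a j w ->
  P.-integrable setT (fun t => (F j w (D i t))%:E).
Proof.
move=> jw; apply: (@ae_bounded_integrable _ _ _ _ _ (kappa * M)).
  exact: measurable_comp_sample.
apply: filterS N_le => t tM; apply: le_trans (F_le _ jw) _.
by rewrite ler_wpM2l.
Qed.

Lemma measurable_dinc j k z : measurable_fun setT (dinc j k z).
Proof.
rewrite /dinc /dyadic_inc; apply: measurable_funB => //.
by case: k => [|k]; [exact: measurable_cst|exact: mF].
Qed.

Lemma half_lt (k i : nat) : (i < 2 ^ k.+1)%N -> (i./2 < 2 ^ k)%N.
Proof. by rewrite expnS mul2n => ik; rewrite ltn_half_double. Qed.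

(** At positive levels the Lipschitz bound is applied to child and parent, whose coordinate
    distances add up to at most [2 a / 2^k <= h / 2^k]. At level 0 the increment is a value and
    [F_le] takes over. *)
Lemma dinc_le j k z x : (z.1 < 2 ^ k)%N -> (z.2 < 2 ^ k)%N ->
  `|dinc j k z x| <= kappa / 2 ^+ k * N j x.
Proof.
move=> z1 z2; have jz := dyadic_pt_in_cell a_gt0 j z1 z2.
case: k => [|k] in z1 z2 jz *; first by rewrite /dinc /dyadic_inc subr0 expr0 divr1 F_le.
have jz' := @dyadic_pt_in_cell _ _ a_gt0 j k (z.1./2, z.2./2) (half_lt z1) (half_lt z2).
apply: le_trans (F_lip _ jz jz') _; rewrite ler_wpM2r// ler_wpM2l//.
have [h1 h2] := dyadic_pt_parent a_gt0 j k z.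
rewrite ler_pdivrMr//; apply: le_trans (lerD h1 h2) _.
rewrite -mulrDl mulrC ler_wpM2l ?invr_ge0 ?exprn_ge0//.
by apply: le_trans ah; rewrite mulr_natl mulr2n.
Qed.

(** Centring commutes with increments, so a scaled increment of the deviation is a sum of centred
    independent terms, as [cosh_sum_le] requires. *)
Lemma dev_inc (c : R) j k z t : (z.1 < 2 ^ k)%N -> (z.2 < 2 ^ k)%N ->
  \sum_i (c * dinc j k z (D i t) - \int[P]_u (c * dinc j k z (D i u))) =
  c * dyadic_inc a (dev j ^~ t) j k z.
Proof.
move=> z1 z2; have jz := dyadic_pt_in_cell a_gt0 j z1 z2.
have idinc i : P.-integrable setT (fun t => (dinc j k z (D i t))%:E).
  apply: (@ae_bounded_integrable _ _ _ _ _ (kappa / 2 ^+ k * M)).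
    by apply: measurable_comp_sample; exact: measurable_dinc.
  apply: filterS N_le => u uM; apply: le_trans (dinc_le _ _ z1 z2) _.
  by rewrite ler_wpM2l// divr_ge0// exprn_ge0.
transitivity (\sum_i c * (dinc j k z (D i t) - \int[P]_u dinc j k z (D i u))).
  by apply: eq_bigr => i _; rewrite (RintegralZl c measurableT (idinc i)) -mulrBr.
rewrite -mulr_sumr; congr (_ * _).
case: k => [|k] in z1 z2 jz idinc *.
  rewrite /dinc /dyadic_inc subr0; apply: eq_bigr => i _; rewrite subr0; congr (_ - _).
  by apply: eq_Rintegral => u _; rewrite subr0.
have jz' := @dyadic_pt_in_cell _ _ a_gt0 j k (z.1./2, z.2./2) (half_lt z1) (half_lt z2).
rewrite /dinc /dyadic_inc /dev -sumrB; apply: eq_bigr => i _.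
rewrite RintegralB//; last 2 first.
- exact: integrable_F.
- exact: integrable_F.
by ring.
Qed.

(** * Simultaneous control of the dyadic increments *)

Section Levels.
Variables (theta Lam : R) (k0 : nat).
Hypothesis theta_ge0 : 0 <= theta.
Hypothesis theta_le1 : theta <= 1.
Hypothesis V_ge0 : 0 <= V.
Hypothesis theta_Lam : theta ^+ 2 * (n%:R * h ^+ 2) <= Lam.

Let scale k := theta * (4 / 3) ^+ k.
Let xi j k z x := scale k * dinc j k z x.
Let Y j k z t := scale k * dyadic_inc a (dev j ^~ t) j k z.
Let beta := kappa * M.
Let E0 := expR (expR beta * (kappa ^+ 2 * M * V * Lam)).

Lemma xi_le j k z x : (z.1 < 2 ^ k)%N -> (z.2 < 2 ^ k)%N ->
  `|xi j k z x| <= theta * kappa * N j x.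
Proof.
move=> z1 z2; rewrite /xi normrM ger0_norm ?mulr_ge0 ?exprn_ge0//.
apply: le_trans (ler_wpM2l _ (dinc_le _ _ z1 z2)) _; first by rewrite mulr_ge0// exprn_ge0.
have -> : scale k * (kappa / 2 ^+ k * N j x) =
    theta * kappa * N j x * ((4 / 3) ^+ k / 2 ^+ k).
  by rewrite /scale; field; rewrite expf_neq0.
(* The remaining factor is [(2/3)^k]. *)
rewrite ler_piMr ?mulr_ge0//; rewrite -exprVn -exprMn exprn_ile1//; lra.
Qed.

(** In [N^2 <= M N] only one factor is bounded by [M]: the second moment stays linear in the mean
    mass [v j]. *)
Lemma sum_sqr_xi_le j k z : (z.1 < 2 ^ k)%N -> (z.2 < 2 ^ k)%N ->
  \sum_i \int[P]_t (xi j k z (D i t) ^+ 2) <= theta ^+ 2 * kappa ^+ 2 * M * v j.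
Proof.
move=> z1 z2; rewrite /v mulr_sumr; apply: ler_sum => i _.
have mxi : measurable_fun setT (xi j k z).
  by apply: measurable_funM => //; exact: measurable_dinc.
have sqr_le : {ae P, forall t,
    xi j k z (D i t) ^+ 2 <= theta ^+ 2 * kappa ^+ 2 * M * N j (D i t)}.
  apply: filterS N_le => t tM.
  have := xi_le j (D i t) z1 z2; rewrite -(@ler_pXn2r _ 2) ?nnegrE ?mulr_ge0//.
  rewrite real_normK ?num_real// => /le_trans; apply.
  have -> : (theta * kappa * N j (D i t)) ^+ 2 =
    theta ^+ 2 * kappa ^+ 2 * (N j (D i t) * N j (D i t)) by ring.
  rewrite -[leRHS]mulrA.
  by rewrite ler_wpM2l ?mulr_ge0 ?sqr_ge0// ler_wpM2r.
rewrite -RintegralZl//; last exact: integrable_count.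
rewrite /Rintegral; apply: fine_le.
- apply: integrable_fin_num => //.
  apply: (@ae_bounded_integrable _ _ _ _ _ (theta ^+ 2 * kappa ^+ 2 * M * M)).
    by apply: measurable_funX; exact: measurable_comp_sample.
  apply: filterS2 N_le sqr_le => t tM /le_trans tx.
  rewrite ger0_norm ?sqr_ge0//; apply: tx.
  by rewrite ler_wpM2l// !mulr_ge0 ?sqr_ge0.
- by apply: integrable_fin_num => //; exact: (integrableZl measurableT _ (integrable_count i j)).
apply: ae_ge0_le_integral => //.
- by move=> t _; rewrite lee_fin sqr_ge0.
- by apply/measurable_EFinP; apply: measurable_funX; exact: measurable_comp_sample.
- by move=> t _; rewrite lee_fin !mulr_ge0 ?sqr_ge0.
- apply/measurable_EFinP; apply: measurable_funM => //.
  exact: measurable_comp_sample.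
- by apply: filterS sqr_le => t tx _; rewrite lee_fin.
Qed.

(** The factor [v j] is kept outside the exponential, to be summed over the cells. Inside, it is
    replaced by its uniform bound [n V h^2], and [theta_Lam] turns the exponent into a multiple of
    [Lam]. *)
Lemma cosh_inc_le j k z : (z.1 < 2 ^ k)%N -> (z.2 < 2 ^ k)%N ->
  (\int[P]_t (coshR (Y j k z t) - 1)%:E <=
   (expR beta * E0 * theta ^+ 2 * kappa ^+ 2 * M * v j)%:E)%E.
Proof.
move=> z1 z2; under eq_integral do rewrite /Y -(dev_inc _ _ _ z1 z2).
have mxi : measurable_fun setT (xi j k z).
  by apply: measurable_funM => //; exact: measurable_dinc.
have xib i : {ae P, forall t, `|xi j k z (D i t)| <= beta}.
  apply: filterS N_le => t tM; apply: le_trans (xi_le _ _ z1 z2) _.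
  rewrite /beta -[kappa * M]mul1r mulrA; apply: ler_pM; rewrite ?mulr_ge0//.
  exact: ler_wpM2r.
apply: le_trans (cosh_sum_le indep (fun=> mxi) xib (sum_sqr_xi_le j z1 z2)) _.
have v0 : 0 <= v j.
  by apply: sumr_ge0 => i _; apply: Rintegral_ge0 => t _.
have vle : v j <= n%:R * (V * h ^+ 2).
  rewrite /v; apply: le_trans (ler_sum _ (fun i _ => meanN_le i j)) _.
  by rewrite sumr_const card_ord mulr_natl.
rewrite lee_fin.
have -> : expR beta * E0 * theta ^+ 2 * kappa ^+ 2 * M * v j =
   expR beta * (theta ^+ 2 * kappa ^+ 2 * M * v j) * E0 by ring.
rewrite ler_wpM2l ?mulr_ge0 ?expR_ge0 ?sqr_ge0// /E0 ler_expR.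
rewrite ler_wpM2l ?expR_ge0//.
apply: (@le_trans _ _ (kappa ^+ 2 * M * V * (theta ^+ 2 * (n%:R * h ^+ 2)))).
  have -> : kappa ^+ 2 * M * V * (theta ^+ 2 * (n%:R * h ^+ 2)) =
    theta ^+ 2 * kappa ^+ 2 * M * (n%:R * (V * h ^+ 2)) by ring.
  by rewrite ler_wpM2l ?mulr_ge0 ?sqr_ge0.
by rewrite ler_wpM2l ?mulr_ge0 ?sqr_ge0.
Qed.

Let W t := \sum_(k < k0) (8^-1 ^+ k * \sum_(j : 'I_m * 'I_m)
  \sum_(z : 'I_(2 ^ k) * 'I_(2 ^ k))
    (coshR (Y (val j.1, val j.2) k (val z.1, val z.2) t) - 1)).

Lemma measurable_dev j w : measurable_fun setT (dev j w).
Proof.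
apply: measurable_sum => i; apply: measurable_funB => //.
exact: measurable_comp_sample.
Qed.

Lemma measurable_cosh_inc j k z :
  measurable_fun setT (fun t => coshR (Y j k z t) - 1).
Proof.
apply: measurable_funB => //; apply: (measurableT_comp (@measurable_coshR R)).
apply: measurable_funM => //; apply: measurable_funB; first exact: measurable_dev.
by case: k => [|k]; [exact: measurable_cst|exact: measurable_dev].
Qed.

(** Level [k] contributes [8^-k * 4^k = 2^-k] times the sum of the [v j], whence the factor 2. That
    sum is at most [n ov M] by the bounded overlap, whatever the number of cells. *)
Lemma expectation_W_le :
  (\int[P]_t (W t)%:E <= (2 * ov * expR beta * E0 * (theta ^+ 2 * n%:R) *
     kappa ^+ 2 * M ^+ 2)%:E)%E.
Proof.
pose G := expR beta * E0 * theta ^+ 2 * kappa ^+ 2 * M.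
have G0 : 0 <= G by rewrite !mulr_ge0 ?expR_ge0 ?sqr_ge0.
have sumv : \sum_(j : 'I_m * 'I_m) v (val j.1, val j.2) <= n%:R * (ov * M).
  rewrite /v exchange_big/=.
  have -> : n%:R * (ov * M) = \sum_(i < n) (ov * M).
    by rewrite sumr_const card_ord mulr_natl.
  apply: ler_sum => i _; rewrite -lee_fin -sumEFin.
  under eq_bigr do rewrite fineK ?(integrable_fin_num _ (integrable_count _ _))//.
  rewrite -ge0_integral_sum//; last 2 first.
  - by move=> j; apply/measurable_EFinP; exact: measurable_comp_sample.
  - by move=> j t _; rewrite lee_fin.
  apply: (@le_trans _ _ (\int[P]_t (ov * M)%:E)%E); last first.
    by rewrite integral_cst//= probability_setT mule1.
  apply: ae_ge0_le_integral => //.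
  - by move=> t _; apply: sume_ge0 => j _; rewrite lee_fin.
  - apply: emeasurable_sum => j; apply/measurable_EFinP.
    exact: measurable_comp_sample.
  - by move=> t _; rewrite lee_fin mulr_ge0.
  - by apply: filterS sumN_le => t tM _; rewrite sumEFin lee_fin.
have mterm k (j : 'I_m * 'I_m) (z : 'I_(2 ^ k) * 'I_(2 ^ k)) :
    measurable_fun setT (fun t => (coshR (Y (val j.1, val j.2) k (val z.1, val z.2) t) - 1)%:E).
  by apply/measurable_EFinP; exact: measurable_cosh_inc.
have cosh0 j k z t : (0 <= (coshR (Y j k z t) - 1)%:E)%E.
  by rewrite lee_fin subr_ge0 coshR_ge1.
under eq_integral do rewrite /W -sumEFin.
rewrite ge0_integral_sum//; last 2 first.
- move=> k; apply/measurable_EFinP; apply: measurable_funM => //.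
  by do 2!(apply: measurable_sum => ?); exact: measurable_cosh_inc.
- move=> k t _; rewrite lee_fin mulr_ge0 ?exprn_ge0//.
  by do 2!(apply: sumr_ge0 => ? _); rewrite subr_ge0 coshR_ge1.
apply: (@le_trans _ _ (\sum_(k < k0) (2^-1 ^+ k * (G * (n%:R * (ov * M))))%:E)%E).
  apply: lee_sum => k _; under eq_integral do rewrite EFinM -sumEFin.
  rewrite ge0_integralZl_EFin//; last 2 first.
  - by move=> t _; apply: sume_ge0 => j _; rewrite lee_fin sumr_ge0// => z _;
    rewrite subr_ge0 coshR_ge1.
  - apply: emeasurable_sum => j; apply/measurable_EFinP.
    by apply: measurable_sum => z; exact: measurable_cosh_inc.
  rewrite ge0_integral_sum//; last 2 first.
  - move=> j; apply/measurable_EFinP.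
    by apply: measurable_sum => z; exact: measurable_cosh_inc.
  - by move=> j t _; rewrite lee_fin sumr_ge0// => z _; rewrite subr_ge0 coshR_ge1.
  apply: (@le_trans _ _ ((8^-1 ^+ k)%:E * \sum_(j : 'I_m * 'I_m)
      (4 ^+ k * (G * v (val j.1, val j.2)))%:E)%E).
    apply: lee_wpmul2l; first by rewrite lee_fin exprn_ge0.
    apply: lee_sum => j _; under eq_integral do rewrite -sumEFin.
    rewrite ge0_integral_sum//.
    apply: (@le_trans _ _ (\sum_(z : 'I_(2 ^ k) * 'I_(2 ^ k)) (G * v (val j.1, val j.2))%:E)%E).
      by apply: lee_sum => z _; apply: cosh_inc_le => /=; exact: ltn_ord.
    rewrite sumEFin sumr_const card_prod !card_ord -[X in (X%:E <= _)%E]mulr_natl.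
    by rewrite natrM natrX -exprMn -natrM.
  rewrite sumEFin -EFinM lee_fin -!mulr_sumr mulrA -exprMn.
  rewrite (_ : 8^-1 * 4 = 2^-1 :> R); last by field.
  by rewrite ler_wpM2l ?exprn_ge0// ler_wpM2l.
rewrite sumEFin lee_fin -mulr_suml.
have -> : 2 * ov * expR beta * E0 * (theta ^+ 2 * n%:R) * kappa ^+ 2 * M ^+ 2 =
  2 * (G * (n%:R * (ov * M))) by rewrite /G; ring.
rewrite ler_wpM2r ?mulr_ge0 ?expR_ge0//.
have geom k : \sum_(l < k) 2^-1 ^+ l = 2 - 2 * 2^-1 ^+ k :> R.
  elim: k => [|k IH]; first by rewrite big_ord0 expr0; ring.
  by rewrite big_ord_recr/= IH exprS; field.
by rewrite geom gerBl mulr_ge0// exprn_ge0.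
Qed.

(** Markov's inequality for [W] at the threshold [c]; since all summands of [W] are nonnegative,
    each is bounded by [W]. *)
Lemma good_event (delta c : R) : 0 < delta -> 0 < c ->
  2 * ov * expR beta * E0 * (theta ^+ 2 * n%:R) * kappa ^+ 2 * M ^+ 2 <= delta * c ->
  exists A, [/\ measurable A, ((1 - delta)%:E <= P A)%E &
    forall t, A t -> (forall i j, N j (D i t) <= M) /\
      forall k z (j : nat * nat), (k < k0)%N -> (j.1 < m)%N -> (j.2 < m)%N ->
        (z.1 < 2 ^ k)%N -> (z.2 < 2 ^ k)%N -> coshR (Y j k z t) - 1 <= 8 ^+ k * c].
Proof.
move=> delta0 c0 hc.
have mW : measurable_fun setT W.
  apply: measurable_sum => k; apply: measurable_funM => //.
  by do 2!(apply: measurable_sum => ?); exact: measurable_cosh_inc.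
have W0 t : 0 <= W t.
  apply: sumr_ge0 => k _; rewrite mulr_ge0 ?exprn_ge0//.
  by do 2!(apply: sumr_ge0 => ? _); rewrite subr_ge0 coshR_ge1.
pose B := [set t | c <= W t].
have mB : measurable B.
  have -> : B = W @^-1` [set` `[c, +oo[].
    by apply/seteqP; split => t; rewrite /= in_itv/= andbT.
  by rewrite -[X in measurable X]setTI; apply: mW.
have PB : (P B <= delta%:E)%E.
  have : (c%:E * P B <= (delta * c)%:E)%E.
    apply: (@le_trans _ _ (\int[P]_t (W t)%:E)%E); last first.
      by apply: le_trans expectation_W_le _; rewrite lee_fin.
    rewrite -[X in P X]setIT -integral_indic// -ge0_integralZl_EFin//; last 2 first.
    - by apply/measurable_EFinP; exact: measurable_indic.
    - exact: ltW.
    apply: ge0_le_integral => //.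
    - by move=> t _; rewrite mule_ge0// lee_fin// ltW.
    - by apply: emeasurable_funM => //; apply/measurable_EFinP; exact: measurable_indic.
    - exact/measurable_EFinP.
    - move=> t _; rewrite -EFinM lee_fin indicE.
      by have [/set_mem|] := boolP (t \in B); rewrite ?mulr1 ?mulr0.
  by rewrite mulrC EFinM lee_pmul2l.
(* Removing a null set makes the almost sure bound on [N] valid at every outcome that is kept. *)
have [Z [mZ PZ ZN]] := N_le.
exists (~` (B `|` Z)); split.
- by apply: measurableC; exact: measurableU.
- rewrite probability_setC; last exact: measurableU.
  rewrite EFinB leeB//; apply: le_trans PB.
  by apply: le_trans (measureU2 _ mB mZ) _; rewrite [X in (_ + X <= _)%E]PZ adde0.
- rewrite setCU => t [Bt Zt]; split; first by apply: contrapT => H; apply: Zt; apply: ZN.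
  move=> k z j kk0 j1 j2 z1 z2.
  have {}Bt : W t <= c by rewrite leNgt; apply/negP => /ltW.
  rewrite mulrC -ler_pdivrMr ?exprn_gt0// mulrC -exprVn; apply: le_trans Bt.
  rewrite /W (bigD1 (Ordinal kk0))//= -[leLHS]addr0 lerD//; last first.
    apply: sumr_ge0 => k' _; rewrite mulr_ge0 ?exprn_ge0//.
    by do 2!(apply: sumr_ge0 => ? _); rewrite subr_ge0 coshR_ge1.
  rewrite ler_wpM2l ?exprn_ge0// (bigD1 (Ordinal j1, Ordinal j2))//=.
  rewrite -[leLHS]addr0 lerD//; last first.
    by do 2!(apply: sumr_ge0 => ? _); rewrite subr_ge0 coshR_ge1.
  rewrite (bigD1 (Ordinal z1, Ordinal z2))//= -!surjective_pairing -[leLHS]addr0 lerD//.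
  by apply: sumr_ge0 => ? _; rewrite subr_ge0 coshR_ge1.
Qed.

(** A crude bound of order [n], used only between [w] and the end of its truncated branch, where the
    choice of [k0] makes it at most 1. The factor 2 counts the sample and its mean. *)
Lemma dev_lip j y w t : in_cell a j y -> in_cell a j w ->
  (forall i, N j (D i t) <= M) ->
  `|dev j y t - dev j w t| <=
    n%:R * (2 * (kappa * M * ((`|y.1 - w.1| + `|y.2 - w.2|) / h))).
Proof.
move=> jv jw NM; set r := (_ + _) / h.
have r0 : 0 <= r by rewrite divr_ge0 ?addr_ge0// ltW.
have lip i u : N j (D i u) <= M -> `|F j y (D i u) - F j w (D i u)| <= kappa * M * r.
  move=> NMu; apply: le_trans (F_lip _ jv jw) _.
  by rewrite -/r [leRHS]mulrAC ler_wpM2l// mulr_ge0.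
have iv i := integrable_F i jv; have iw i := integrable_F i jw.
have imean i : `|\int[P]_u F j y (D i u) - \int[P]_u F j w (D i u)| <= kappa * M * r.
  rewrite -(RintegralB measurableT (iv i) (iw i)).
  apply: le_trans (le_normr_Rintegral _ _) _ => //.
    exact: (integrableB measurableT (iv i) (iw i)).
  rewrite -lee_fin fineK; last first.
    apply: integrable_fin_num => //.
    exact: (integrable_norm (integrableB measurableT (iv i) (iw i))).
  apply: (@le_trans _ _ (\int[P]_t (kappa * M * r)%:E)%E); last first.
    by rewrite integral_cst//= probability_setT mule1.
  apply: ae_ge0_le_integral => //.
  - apply/measurable_EFinP; apply: measurableT_comp => //.
    by apply: measurable_funB; exact: measurable_comp_sample.
  - by move=> u _; rewrite lee_fin mulr_ge0// mulr_ge0.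
  - by apply: filterS N_le => u uM _; rewrite lee_fin lip.
rewrite /dev -sumrB; apply: le_trans (ler_norm_sum _ _ _) _.
have -> : n%:R * (2 * (kappa * M * r)) = \sum_(i < n) (2 * (kappa * M * r)).
  by rewrite sumr_const card_ord mulr_natl.
apply: ler_sum => i _.
have -> : F j y (D i t) - \int[P]_u F j y (D i u) -
    (F j w (D i t) - \int[P]_u F j w (D i u)) =
  (F j y (D i t) - F j w (D i t)) -
    (\int[P]_u F j y (D i u) - \int[P]_u F j w (D i u)) by ring.
apply: le_trans (ler_normB _ _) _; rewrite [leRHS]mulr_natl mulr2n.
by apply: lerD => //; apply: lip.
Qed.

(* The weights [(3 / 4) ^+ k] are summable even against [k], whereas
   increments of level [k] are of order [2 ^- k]. *)
Lemma chaining_dev_le (c : R) w t : 0 < c -> 0 < theta ->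
  0 <= w.1 -> 0 <= w.2 ->
  ((cell_of a w).1 < m)%N -> ((cell_of a w).2 < m)%N ->
  (forall i j, N j (D i t) <= M) ->
  (forall k z (j : nat * nat), (k < k0)%N -> (j.1 < m)%N -> (j.2 < m)%N ->
    (z.1 < 2 ^ k)%N -> (z.2 < 2 ^ k)%N -> coshR (Y j k z t) - 1 <= 8 ^+ k * c) ->
  (0 < k0)%N ->
  2 * n%:R * kappa * M / 2 ^+ k0.-1 <= 1 ->
  theta * `|dev (cell_of a w) w t| <= 4 * ln (2 * (1 + c)) + 12 * ln 8 + 1.
Proof.
move=> c0 theta0 w1 w2 j1 j2 NM cosh_le k00 rem.
set j := cell_of a w in j1 j2 *.
set L := ln (2 * (1 + c)).
have L0 : 0 <= L by rewrite ln_ge0//; lra.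
have l80 : 0 <= ln (8 : R) by rewrite ln_ge0//; lra.
have inc_le k z : (k <= k0.-1)%N -> (z.1 < 2 ^ k)%N -> (z.2 < 2 ^ k)%N ->
    `|dyadic_inc a (dev j ^~ t) j k z| <= (3 / 4) ^+ k * (ln 8 * k%:R + L) / theta.
  move=> kk0 z1 z2; have kk : (k < k0)%N by rewrite -(prednK k00) ltnS.
  have s0 : 0 < scale k by rewrite mulr_gt0// exprn_gt0.
  have := le_ln_coshR _ (cosh_le k z j kk j1 j2 z1 z2).
  rewrite mulr_ge0 ?exprn_ge0 ?(ltW c0)// => /(_ isT).
  rewrite /Y normrM (gtr0_norm s0) mulrC -ler_pdivlMr// => /le_trans; apply.
  have -> : (3 / 4) ^+ k * (ln 8 * k%:R + L) / theta = (ln 8 * k%:R + L) / scale k.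
    have -> : scale k = theta / (3 / 4) ^+ k by rewrite /scale -exprVn invf_div.
    by rewrite invf_div mulrCA mulrA.
  apply: ler_wpM2r; first by rewrite invr_ge0 ltW.
  have -> : ln 8 * k%:R + L = ln (8 ^+ k * (2 * (1 + c))).
    rewrite lnM ?posrE ?exprn_gt0 ?mulr_gt0//; last by lra.
    by rewrite lnXn// mulr_natr.
  rewrite ler_ln ?posrE ?mulr_gt0 ?exprn_gt0//;
    [|by rewrite ltr_pwDl// mulr_ge0 ?exprn_ge0 ?ltW|by lra].
  (* From here [1 + 8^k c <= 8^k (1 + c)], so the threshold of level [k] costs only [k ln 8] more
     than that of level 0. *)
  have e1 : 1 <= 8 ^+ k :> R by rewrite exprn_ege1//; lra.
  by rewrite mulrCA ler_wpM2l// mulrDr mulr1 lerD2r.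
have ch := chaining_le a_gt0 w1 w2 inc_le.
have w_near := @dyadic_pt_idx _ _ a_gt0 w k0.-1 w1 w2.
set u := dyadic_pt _ _ _ _ in ch w_near.
have [i1 i2] := dyadic_idx_lt a_gt0 k0.-1 w1 w2.
have ju : in_cell a j u by exact: dyadic_pt_in_cell.
have jw : in_cell a j w by exact: in_cell_of.
have := dev_lip jw ju (NM ^~ j); set r := (_ + _) / h => drem.
have rle : r <= (2 ^+ k0.-1)^-1.
  rewrite ler_pdivrMr//; apply: le_trans (lerD w_near.1 w_near.2) _.
  rewrite -mulrDl mulrC ler_wpM2l ?invr_ge0 ?exprn_ge0//.
  by apply: le_trans ah; rewrite mulr_natl mulr2n.
have drem1 : `|dev j w t - dev j u t| <= 1.
  apply: le_trans drem _; apply: le_trans rem.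
  have -> : 2 * n%:R * kappa * M / 2 ^+ k0.-1 =
    n%:R * (2 * (kappa * M * (2 ^+ k0.-1)^-1)) by ring.
  by rewrite !ler_wpM2l// mulr_ge0.
have -> : dev j w t = (dev j w t - dev j u t) + dev j u t by ring.
apply: le_trans (ler_wpM2l theta_ge0 (ler_normD _ _)) _.
rewrite mulrDr addrC; apply: lerD; last first.
  by rewrite -[leRHS]mul1r ler_pM.
apply: le_trans (ler_wpM2l theta_ge0 ch) _.
rewrite mulr_sumr.
under eq_bigr do rewrite mulrC divfK ?gt_eqF//.
exact: geometric_affine_sum_le.
Qed.

End Levels.
(** The cap [theta <= 1] keeps the scaled increments below [kappa M], and [theta <= sqrt (Lam / mm)]
    gives [theta^2 mm <= Lam]. Dividing [theta * dev <= C Lam] by [theta] yields [C Lam] or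
    [C sqrt (mm Lam)], according to which term is the minimum. *)
Theorem uniform_concentration (h0 delta : R) :
  (0 < n)%N -> 0 <= V -> h <= h0 -> h0 < 1 -> 0 < delta < 1 ->
  exists A, [/\ measurable A, ((1 - delta)%:E <= P A)%E &
    forall t, A t -> (forall i j, N j (D i t) <= M) /\
      forall w, 0 <= w.1 -> 0 <= w.2 ->
        ((cell_of a w).1 < m)%N -> ((cell_of a w).2 < m)%N ->
        `|dev (cell_of a w) w t| <= conc_const kappa M V ov h0 *
          Num.max (ln ((delta * h ^+ 2)^-1))
            (Num.sqrt (n%:R * h ^+ 2 * ln ((delta * h ^+ 2)^-1)))].
Proof.
move=> n0 V0 hh0 h01 /andP[d0 d1].
set Lam := ln ((delta * h ^+ 2)^-1); set Lam0 := ln (h0 ^- 2).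
have h00 : 0 < h0 by exact: lt_le_trans hh0.
have h1 : h < 1 by exact: le_lt_trans h01.
have Lam00 : 0 < Lam0.
  by rewrite ln_gt0// invf_gt1 ?exprn_gt0// exprn_ilt1// ltW.
have dh0 : 0 < delta * h ^+ 2 by rewrite mulr_gt0 ?exprn_gt0.
have Lam0le : Lam0 <= Lam.
  rewrite ler_ln ?posrE ?invr_gt0 ?exprn_gt0// lef_pV2 ?posrE ?exprn_gt0//.
  apply: (@le_trans _ _ (1 * h ^+ 2)); first by rewrite ler_wpM2r ?sqr_ge0// ltW.
  by rewrite mul1r lerXn2r ?nnegrE// ltW.
have Lamgt0 : 0 < Lam by exact: lt_le_trans Lam0le.
have eLam : expR Lam = (delta * h ^+ 2)^-1 by rewrite lnK// posrE invr_gt0.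
have hLam : h ^- 2 <= expR Lam.
  rewrite eLam lef_pV2 ?posrE ?exprn_gt0//.
  by rewrite -[leRHS]mul1r ler_wpM2r ?sqr_ge0// ltW.
have dLam : delta^-1 <= expR Lam.
  rewrite eLam lef_pV2 ?posrE// -[leRHS]mulr1 ler_wpM2l ?(ltW d0)//.
  by apply: exprn_ile1; exact: ltW.
have mm0 : 0 < n%:R * h ^+ 2 by rewrite mulr_gt0 ?exprn_gt0// ltr0n.
set mm := n%:R * h ^+ 2 in mm0 *.
pose theta := Num.min 1 (Num.sqrt (Lam / mm)).
have theta0 : 0 < theta by rewrite lt_min ltr01/= sqrtr_gt0 divr_gt0.
have theta1 : theta <= 1 by rewrite ge_min lexx.
have thetaL : theta ^+ 2 * mm <= Lam.
  rewrite -ler_pdivlMr// -[leRHS]sqr_sqrtr ?divr_ge0 ?(ltW Lamgt0) ?(ltW mm0)//.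
  by rewrite lerXn2r ?nnegrE ?sqrtr_ge0 ?(ltW theta0)// ge_min lexx orbT.
set b := 2 * ov * expR (kappa * M) * kappa ^+ 2 * M ^+ 2.
set g := expR (kappa * M) * (kappa ^+ 2 * M * V) + 2.
have b0 : 0 <= b by rewrite !mulr_ge0 ?expR_ge0 ?sqr_ge0.
have g0 : 2 <= g by rewrite lerDr !mulr_ge0 ?expR_ge0 ?sqr_ge0.
(* Chosen so that [delta c] exceeds the bound on the mean of the dyadic sum; the summand 1 keeps [c]
   positive when [b = 0]. *)
pose c := (b * expR (g * Lam) + 1) / delta.
have eg1 : 1 <= expR (g * Lam).
  by rewrite -expR0 ler_expR mulr_ge0 ?(ltW Lamgt0)// (le_trans _ g0).
have c0 : 0 < c by rewrite divr_gt0// ltr_wpDl// mulr_ge0 ?expR_ge0.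
have hEW : 2 * ov * expR (kappa * M) *
    expR (expR (kappa * M) * (kappa ^+ 2 * M * V * Lam)) *
    (theta ^+ 2 * n%:R) * kappa ^+ 2 * M ^+ 2 <= delta * c.
  have -> : delta * c = b * expR (g * Lam) + 1 by rewrite /c mulrC divfK// gt_eqF.
  apply: (@le_trans _ _ (b * expR (g * Lam))); last by rewrite lerDl.
  (* The 2 in [g] pays for [theta^2 n = (theta^2 mm) h^-2]: one [exp Lam] for each factor. *)
  have -> : g * Lam = expR (kappa * M) * (kappa ^+ 2 * M * V * Lam) + (Lam + Lam).
    by rewrite /g; ring.
  rewrite expRD; set E1 := expR (expR _ * _).
  have -> : 2 * ov * expR (kappa * M) * E1 * (theta ^+ 2 * n%:R) * kappa ^+ 2 * M ^+ 2 =
    b * (E1 * (theta ^+ 2 * n%:R)) by rewrite /b; ring.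
  rewrite ler_wpM2l// ler_wpM2l ?expR_ge0//.
  have -> : theta ^+ 2 * n%:R = theta ^+ 2 * mm * h ^- 2.
    by rewrite /mm; field; rewrite gt_eqF.
  rewrite expRD; apply: ler_pM => //.
  - by apply: mulr_ge0; [exact: sqr_ge0|exact: ltW].
  - by rewrite invr_ge0 sqr_ge0.
  apply: le_trans thetaL _; apply: le_trans (expR_ge1Dx _).
  by rewrite lerDr.
pose x := 2 * n%:R * kappa * M.
have x0 : 0 <= x by rewrite !mulr_ge0.
(* The last level is [k0 - 1], an integer larger than [x], hence [2^(k0-1) >= x]. *)
pose k0 := (Num.truncn x).+2.
have rem : 2 * n%:R * kappa * M / 2 ^+ k0.-1 <= 1.
  rewrite ler_pdivrMr ?exprn_gt0// mul1r -/x.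
  have /andP[_ /ltW xk] := truncn_itv x0; apply: le_trans xk _.
  by rewrite -natrX ler_nat ltnW// ltn_expl.
have [A [mA PA HA]] := @good_event theta Lam k0 (ltW theta0) theta1 V0 thetaL delta c d0 c0 hEW.
exists A; split => // t At; have [NM cosh_le] := HA t At; split => // w w1 w2 j1 j2.
have := @chaining_dev_le theta k0 (ltW theta0) theta1 c w t c0 theta0 w1 w2 j1 j2
  NM cosh_le isT rem.
have y0 : 0 <= `|dev (cell_of a w) w t| by [].
move: y0; set y := `|dev _ _ _|; set C := conc_const _ _ _ _ _ => y0 hy.
have b2 : 0 < 2 * (b + 2) by lra.
(* The additional [Lam] accounts for [1 / delta <= exp Lam]. *)
have lnc : ln (2 * (1 + c)) <= ln (2 * (b + 2)) + (g + 1) * Lam.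
  have -> : ln (2 * (b + 2)) + (g + 1) * Lam = ln (2 * (b + 2) * expR ((g + 1) * Lam)).
    by rewrite [in RHS]lnM ?posrE ?expR_gt0// expRK.
  rewrite ler_ln ?posrE; last 2 first.
  - by rewrite mulr_gt0// addr_gt0.
  - by rewrite mulr_gt0 ?expR_gt0.
  rewrite -mulrA ler_wpM2l//.
  have d1' : 1 <= delta^-1 by rewrite invf_ge1// ltW.
  have -> : (g + 1) * Lam = g * Lam + Lam by ring.
  rewrite expRD; apply: (@le_trans _ _ ((b + 2) * (expR (g * Lam) * delta^-1))).
    rewrite /c mulrA ler_pdivlMr// mulrDl divfK ?gt_eqF// mul1r.
    by have := ltW d1; have := ler_wpM2l b0 eg1; nra.
  by rewrite ler_wpM2l ?addr_ge0// ler_wpM2l ?expR_ge0.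
have C0 : C * Lam >= 4 * (ln (2 * (b + 2)) + (g + 1) * Lam) + 12 * ln 8 + 1.
  rewrite /C /conc_const -/b -/g -/Lam0.
  set q := 4 * ln (2 * (b + 2)) + 12 * ln 8 + 1.
  have q0 : 0 <= q.
    by rewrite !addr_ge0// mulr_ge0// ln_ge0//; lra.
  have : q <= q / Lam0 * Lam.
    by rewrite -mulrA ler_peMr// mulrC ler_pdivlMr// mul1r.
  by rewrite /q; lra.
have {}hy : theta * y <= C * Lam.
  by apply: le_trans hy (le_trans _ C0); rewrite !lerD2r ler_wpM2l.
have Cge0 : 0 <= C.
  rewrite -(pmulr_lge0 _ Lamgt0); apply: le_trans hy.
  by rewrite mulr_ge0 ?(ltW theta0).
rewrite maxr_pMr// le_max.
have [le1|gt1] := leP 1 (Num.sqrt (Lam / mm)).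
  by move: hy; rewrite /theta min_l// mul1r => ->.
apply/orP; right; move: hy; rewrite /theta min_r ?(ltW gt1)//.
have s0 : 0 < Num.sqrt (Lam / mm) by rewrite sqrtr_gt0 divr_gt0.
rewrite mulrC -ler_pdivlMr// => /le_trans; apply.
rewrite -mulrA ler_wpM2l// ler_pdivrMr// -sqrtrM ?(mulr_ge0 (ltW mm0) (ltW Lamgt0))//.
have -> : mm * Lam * (Lam / mm) = Lam ^+ 2 by field; rewrite gt_eqF.
by rewrite sqrtr_sqr ger0_norm// ltW.
Qed.

End Concentration.

(** * Kernel estimators *)

Lemma leb2_sigma_finite (R : realType) : sigma_finite setT (@leb2 R).
Proof.
have /sigma_finiteP[F [TF ndF Foo]] := sigma_finiteT (@lebesgue_measure R).
exists (fun n => F n `*` F n).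
  rewrite -setXTT TF predeqE => -[x y]; split.
    move=> [/= [n _ Fnx] [k _ Fky]]; exists (maxn n k) => //; split.
    - by move: x Fnx; exact/subsetPset/ndF/leq_maxl.
    - by move: y Fky; exact/subsetPset/ndF/leq_maxr.
  by move=> [n _ []/= ? ?]; split; exists n.
move=> k; have [mF Fk] := Foo k; split; first exact: measurableX.
by rewrite /leb2/= product_measure1E// lte_mul_pinfty// ge0_fin_numE.
Qed.

(** The type of [leb2] records a measure only, while [deviation_duality] needs sigma-finiteness for
    Fubini. *)
Definition leb2_sigma (R : realType) : {sigma_finite_measure set (plane R) -> \bar R} :=
  HB.pack_for {sigma_finite_measure set (plane R) -> \bar R} (Measure.sort (@leb2 R))
    (Measure_isSigmaFinite.Build _ _ _ (@leb2 R) (@leb2_sigma_finite R)).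

(** * Measurability, area and overlap of the boxes *)

Section PlaneSets.
Context {R : realType}.

Lemma measurable_coord_diff :
  measurable_fun setT (fun x : plane R => x.2 - x.1 : R).
Proof. by apply: measurable_funB; [exact: measurable_snd|exact: measurable_fst]. Qed.

Lemma measurable_Omega (L : R) : measurable (@Omega R L).
Proof.
have -> : @Omega R L = ((fst : plane R -> R) @^-1` [set` `]0, +oo[]) `&`
    ((fun x : plane R => x.2 - x.1 : R) @^-1` [set` `]0, +oo[]) `&`
    ((snd : plane R -> R) @^-1` [set` `]-oo, L]]).
  apply/seteqP; split => x; rewrite /Omega /= !in_itv/= !andbT subr_gt0.
    by move=> [? []].
  by move=> [[]].
apply: measurableI; first apply: measurableI.
- by rewrite -[X in measurable X]setTI; apply: (measurable_fst).
- by rewrite -[X in measurable X]setTI; apply: measurable_coord_diff.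
- by rewrite -[X in measurable X]setTI; apply: (measurable_snd).
Qed.

Lemma measurable_dist_diag (L : R) : measurable_fun (Omega L) (dist_diag L).
Proof.
apply: (@eq_measurable_fun _ _ _ _ _ (fun x : plane R => (x.2 - x.1) / Num.sqrt 2)).
  by move=> x /set_mem Lx; rewrite dist_diag_Omega.
apply: measurable_funM => //; apply: measurable_funTS.
exact: measurable_coord_diff.
Qed.

Lemma measurable_Omega_ge (L l : R) : measurable (@Omega_ge R L l).
Proof.
have -> : @Omega_ge R L l = Omega L `&` (dist_diag L @^-1` [set` `[l, +oo[]).
  by apply/seteqP; split => x; rewrite /Omega_ge /= in_itv/= andbT.
by apply: measurable_dist_diag => //; exact: measurable_Omega.
Qed.

(** The half-side is [9 a = a + h] when [h = 8 a]: a point of the cell is within [a] of the corner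
    in each coordinate, and the scaled kernel has radius [h]. *)
Definition cell_box (L a : R) (j : nat * nat) : set (plane R) :=
  [set x | [/\ Omega L x, `|x.1 - j.1%:R * a| <= 9 * a &
                          `|x.2 - j.2%:R * a| <= 9 * a]].

Lemma cell_boxE L a j : cell_box L a j = Omega L `&`
  ([set` `[j.1%:R * a - 9 * a, j.1%:R * a + 9 * a]] `*`
   [set` `[j.2%:R * a - 9 * a, j.2%:R * a + 9 * a]]).
Proof.
apply/seteqP; split => x; rewrite /cell_box /= !in_itv/= !ler_distl.
  by move=> [].
by move=> [? []].
Qed.

Lemma measurable_cell_box L a j : measurable (cell_box L a j).
Proof.
rewrite cell_boxE; apply: measurableI; first exact: measurable_Omega.
by apply: measurableX; exact: measurable_itv.
Qed.

Lemma leb2_cell_box_le L a j : 0 < a ->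
  (leb2 (cell_box L a j) <= ((18 * a) ^+ 2)%:E)%E.
Proof.
move=> a0; have len (i : nat) :
    lebesgue_measure [set` `[i%:R * a - 9 * a, i%:R * a + 9 * a]] = (18 * a)%:E.
  rewrite lebesgue_measure_itv/= lte_fin ltrD2l ifT; last by lra.
  by rewrite -EFinB; congr EFin; ring.
apply: (@le_trans _ _ (leb2 ([set` `[j.1%:R * a - 9 * a, j.1%:R * a + 9 * a]] `*`
   [set` `[j.2%:R * a - 9 * a, j.2%:R * a + 9 * a]]))).
  apply: le_measure; rewrite ?inE; [exact: measurable_cell_box| |].
    by apply: measurableX; exact: measurable_itv.
  by rewrite cell_boxE => x [].
rewrite /leb2/= product_measure1E; [|exact: measurable_itv|exact: measurable_itv].
by rewrite [X in (X * _ <= _)%E](len j.1) [X in (_ * X <= _)%E](len j.2) -EFinM expr2.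
Qed.

Lemma sum_cell_box_le L a (m : nat) (x : plane R) : 0 < a ->
  \sum_(j : 'I_m * 'I_m) (\1_(cell_box L a (val j.1, val j.2)) x : R) <= 361.
Proof.
move=> a0.
(* Per coordinate, [card_near_le] with radius 9 allows [2 * 9 + 1] indices. *)
have near (y : R) : \sum_(j : 'I_m) (`|y - j%:R * a| <= 9 * a)%R%:R <= 19 :> R.
  have -> : \sum_(j : 'I_m) (`|y - j%:R * a| <= 9 * a)%R%:R =
      #|[set j : 'I_m | (`|y / a - j%:R| <= 9%:R)%R]%SET|%:R :> R.
    rewrite -sum1_card natr_sum [RHS]big_mkcond/=; apply: eq_bigr => j _.
    rewrite inE; have -> : (`|y - j%:R * a| <= 9 * a) = (`|y / a - j%:R| <= 9%:R).
      rewrite -[in LHS](divfK (lt0r_neq0 a0) y) -mulrBl normrM (gtr0_norm a0).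
      by rewrite ler_pM2r.
    by case: (_ <= _).
  by rewrite -[leRHS]/(19%:R) ler_nat; exact: (card_near_le m 9).
apply: (@le_trans _ _ (\sum_(j : 'I_m * 'I_m)
    ((`|x.1 - j.1%:R * a| <= 9 * a)%R%:R * (`|x.2 - j.2%:R * a| <= 9 * a)%R%:R))).
  apply: ler_sum => j _; rewrite indicE.
  have [/set_mem[_ /= -> ->]|_] := boolP (x \in _); first by rewrite mulr1.
  by rewrite mulr_ge0.
have -> : \sum_(j : 'I_m * 'I_m)
    ((`|x.1 - j.1%:R * a| <= 9 * a)%R%:R * (`|x.2 - j.2%:R * a| <= 9 * a)%R%:R) =
  (\sum_(j : 'I_m) (`|x.1 - j%:R * a| <= 9 * a)%R%:R) *
  (\sum_(j : 'I_m) (`|x.2 - j%:R * a| <= 9 * a)%R%:R) :> R.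
  by rewrite mulr_suml -(pair_bigA _ (fun i j : 'I_m => (`|x.1 - i%:R * a| <= 9 * a)%R%:R *
      (`|x.2 - j%:R * a| <= 9 * a)%R%:R)); apply: eq_bigr => i _; rewrite mulr_sumr.
have -> : 361 = 19 * 19 :> R by rewrite -natrM.
by rewrite ler_pM// sumr_ge0.
Qed.

Lemma normr1_le_enorm (x : plane R) : `|x.1| <= enorm x.
Proof. by rewrite /enorm -sqrtr_sqr ler_wsqrtr// lerDl sqr_ge0. Qed.

Lemma normr2_le_enorm (x : plane R) : `|x.2| <= enorm x.
Proof. by rewrite /enorm -sqrtr_sqr ler_wsqrtr// lerDr sqr_ge0. Qed.

Lemma enorm_le (x : plane R) : enorm x <= `|x.1| + `|x.2|.
Proof.
rewrite /enorm -[leRHS]ger0_norm ?addr_ge0// -sqrtr_sqr ler_wsqrtr//.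
rewrite sqrrD !real_normK ?num_real// -mulr_natl.
by have := mulr_ge0 (normr_ge0 x.1) (normr_ge0 x.2); lra.
Qed.

End PlaneSets.

Lemma conc_const_ge0 (R : realType) (kappa M V ov h0 : R) :
  0 <= kappa -> 0 <= M -> 0 <= V -> 0 <= ov -> 0 < h0 < 1 ->
  0 <= conc_const kappa M V ov h0.
Proof.
move=> kappa0 M0 V0 ov0 /andP[h00 h01]; rewrite /conc_const.
set b := 2 * ov * _ * _ * _; set g := expR _ * _ + 2.
have b0 : 0 <= b by rewrite !mulr_ge0 ?expR_ge0 ?sqr_ge0.
have g0 : 0 <= g by apply: addr_ge0 => //; rewrite !mulr_ge0 ?expR_ge0.
apply: addr_ge0; first by rewrite mulr_ge0// addr_ge0.
have l1 : 0 <= ln (2 * (b + 2)) by rewrite ln_ge0//; lra.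
have l2 : 0 <= ln (8 : R) by rewrite ln_ge0//; lra.
apply: divr_ge0; first by rewrite !addr_ge0// mulr_ge0.
by rewrite ln_ge0// invf_ge1 ?exprn_gt0// exprn_ile1// ltW.
Qed.

Section KernelEstimator.
Context {R : realType} {d : measure_display} {T : measurableType d}.
Context (P : probability T R) (n : nat) (D : 'I_n -> {RV P >-> diagram R}).
Variables (L h kappa M c : R) (K : plane R -> R).
(** Both estimators are instances: the counting measure with [rho] the [q]-th power of the distance
    to the diagonal, and the normalized measure with [rho = 1]. *)
Variable nu : seq (plane R) -> {measure set (plane R) -> \bar R}.
Variables (rho p : plane R -> R).
Hypothesis mnu : forall A, measurable A ->
  measurable_fun setT (fun x : diagram R => nu x A).
Hypothesis nu_fin : forall x, (nu x setT < +oo)%E.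
Hypothesis indep : mutually_independent D.
Hypothesis n_gt0 : (0 < n)%N.
Hypothesis h_gt0 : 0 < h.
Hypothesis K_support : forall x, 1 < enorm x -> K x = 0.
Hypothesis K_le : forall x, `|K x| <= kappa.
Hypothesis K_lip : forall x y, `|K x - K y| <= kappa * enorm (x - y).
Hypothesis M_ge0 : 0 <= M.
Hypothesis mrho : measurable_fun (Omega L) rho.
Hypothesis rho_ge0 : forall x, Omega L x -> 0 <= rho x.
Hypothesis total_rho : {ae P, forall t, forall i,
  (\int[nu (D i t)]_(x in Omega L) (rho x)%:E <= M%:E)%E}.
Hypothesis density : forall i,
  is_density L (mean_measure P (fun t => nu (D i t))) p.
Hypothesis c_ge0 : 0 <= c.
Hypothesis rho_p_le : forall x, Omega L x -> rho x * p x <= c.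

Let a := h / 8.
Let m := (Num.truncn (L / a)).+1.

Let a_gt0 : 0 < a. Proof. by rewrite divr_gt0. Qed.

Let kappa_ge0 : 0 <= kappa.
Proof. exact: le_trans (K_le 0). Qed.

Variable Wc : nat * nat -> R.
Hypothesis Wc_ge0 : forall j, 0 <= Wc j.
Hypothesis Wc_le_rho : forall j x, cell_box L a j x -> Wc j <= rho x.

Definition kernel_at (w x : plane R) : R := K ((x - w).1 / h, (x - w).2 / h).

Definition kernel_int (w : plane R) (D0 : seq (plane R)) : R :=
  \int[nu D0]_(x in Omega L) kernel_at w x.

Definition box_mass (j : nat * nat) (D0 : seq (plane R)) : R :=
  Wc j * fine (nu D0 (cell_box L a j)).

(** A consequence of the Lipschitz condition, read off from the joint measurability lemma with a
    dummy parameter. *)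
Lemma measurable_kernel_fun : measurable_fun setT K.
Proof.
have := @measurable_plane_caratheodory R _ (measurableTypeR R) (fun=> K) (fun=> kappa).
move=> /(_ (fun=> measurable_cst _)) mK.
apply: (@eq_measurable_fun _ _ _ _ _
  ((fun xw : measurableTypeR R * plane R => K xw.2) \o pair 0)) => //.
apply: measurableT_comp; last exact: pair1_measurable.
apply: mK => _ v w; apply: le_trans (K_lip _ _) _.
by rewrite ler_wpM2l//; exact: enorm_le.
Qed.

Lemma measurable_kernel_at w : measurable_fun setT (kernel_at w).
Proof.
apply: (measurableT_comp measurable_kernel_fun).
apply/measurable_fun_pairP; split; apply: measurable_funM => //;
  exact: measurable_funB.
Qed.

Lemma nu_finE x A : measurable A -> nu x A \is a fin_num.
Proof.
move=> mA; rewrite ge0_fin_numE//; apply: le_lt_trans (nu_fin x).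
by apply: le_measure; rewrite ?inE.
Qed.

Lemma integrable_kernel_at w D0 :
  (nu D0).-integrable (Omega L) (EFin \o kernel_at w).
Proof.
apply: (bounded_integrable_finite (X := diagram R) nu_fin D0 _ _ (fun x _ => K_le _)).
  exact: measurable_Omega.
by apply: measurable_funTS; exact: measurable_kernel_at.
Qed.

Lemma measurable_kernel_int w :
  measurable_fun setT (kernel_int w : diagram R -> R).
Proof.
apply: (measurable_Rintegral_param (X := diagram R) mnu).
  exact: measurable_Omega.
by apply: measurable_funTS; exact: measurable_kernel_at.
Qed.

Lemma measurable_box_mass j :
  measurable_fun setT (box_mass j : diagram R -> R).
Proof.
apply: measurable_funM => //; apply: (measurableT_comp (fine_measurable _)) => //.
by apply: mnu; exact: measurable_cell_box.
Qed.

Lemma box_mass_ge0 j D0 : 0 <= box_mass j D0.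
Proof. by rewrite mulr_ge0// fine_ge0. Qed.

Lemma kernel_at_out j w x : in_cell a j w -> Omega L x ->
  ~ cell_box L a j x -> kernel_at w x = 0.
Proof.
move=> [w1 w2] Lx nx; apply: K_support.
have far (y v : R) i : i%:R * a <= v <= i.+1%:R * a ->
    9 * a < `|y - i%:R * a| -> 1 < `|(y - v) / h|.
  move=> /andP[v1 v2]; rewrite normrM (@gtr0_norm _ h^-1) ?invr_gt0//.
  rewrite ltr_pdivlMr// mul1r.
  have h8 : h = 8 * a by rewrite /a; field.
  have {v2} : v <= i%:R * a + a by move: v2; rewrite -natr1 mulrDl mul1r.
  rewrite h8 !lter_normr; move: v1 a_gt0; set b := i%:R * a.
  by move=> ? ? ? /orP[?|?]; apply/orP; [left|right]; lra.
have [h1|h1] := leP `|x.1 - j.1%:R * a| (9 * a); last first.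
  apply: lt_le_trans (normr1_le_enorm _); exact: far w1 h1.
have [h2|h2] := leP `|x.2 - j.2%:R * a| (9 * a); last first.
  apply: lt_le_trans (normr2_le_enorm _); exact: far w2 h2.
by exfalso; apply: nx.
Qed.

Lemma kernel_int_le j w D0 : in_cell a j w ->
  `|Wc j * kernel_int w D0| <= kappa * box_mass j D0.
Proof.
move=> jw; rewrite normrM ger0_norm// /box_mass mulrCA ler_wpM2l//.
apply: (normr_Rintegral_le (X := diagram R) nu_fin) => //.
- exact: measurable_Omega.
- exact: measurable_cell_box.
- by move=> x [].
- by apply: measurable_funTS; exact: measurable_kernel_at.
- move=> x Lx; rewrite indicE.
  have [xb|xb] := boolP (x \in _); first by rewrite mulr1; exact: K_le.
  rewrite mulr0 (kernel_at_out jw Lx) ?normr0// => /mem_set.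
  exact/negP.
Qed.

Lemma kernel_at_lip v w x :
  `|kernel_at v x - kernel_at w x| <= kappa * ((`|v.1 - w.1| + `|v.2 - w.2|) / h).
Proof.
apply: le_trans (K_lip _ _) _; rewrite ler_wpM2l//.
apply: le_trans (enorm_le _) _ => /=.
have E (y b e : R) : `|(y - b) / h - (y - e) / h| = `|b - e| / h.
  rewrite -mulrBl normrM (@gtr0_norm _ h^-1) ?invr_gt0//; congr (_ / _).
  by rewrite distrC; congr `|_|; ring.
by rewrite !E mulrDl.
Qed.

Lemma kernel_int_lip j v w D0 : in_cell a j v -> in_cell a j w ->
  `|Wc j * kernel_int v D0 - Wc j * kernel_int w D0| <=
  kappa * ((`|v.1 - w.1| + `|v.2 - w.2|) / h) * box_mass j D0.
Proof.
move=> jv jw; rewrite -mulrBr normrM ger0_norm// /box_mass [leRHS]mulrCA ler_wpM2l//.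
rewrite /kernel_int -RintegralB//; last 3 first.
- exact: measurable_Omega.
- exact: integrable_kernel_at.
- exact: integrable_kernel_at.
have r0 : 0 <= kappa * ((`|v.1 - w.1| + `|v.2 - w.2|) / h).
  by rewrite mulr_ge0// divr_ge0 ?addr_ge0// ltW.
apply: (normr_Rintegral_le (X := diagram R) nu_fin) => //.
- exact: measurable_Omega.
- exact: measurable_cell_box.
- by move=> x [].
- by apply: measurable_funTS; apply: measurable_funB; exact: measurable_kernel_at.
- move=> x Lx; rewrite indicE.
  have [xb|xb] := boolP (x \in _); first by rewrite mulr1; exact: kernel_at_lip.
  have nx : ~ cell_box L a j x by move/mem_set; exact/negP.
  by rewrite mulr0 (kernel_at_out jv Lx nx) (kernel_at_out jw Lx nx) subrr normr0.
Qed.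

Lemma box_mass_integral j D0 :
  ((box_mass j D0)%:E = \int[nu D0]_(x in Omega L) (Wc j * \1_(cell_box L a j) x)%:E)%E.
Proof.
have mO := @measurable_Omega R L; have mB := measurable_cell_box L a j.
under eq_integral do rewrite EFinM.
rewrite ge0_integralZl_EFin//; last first.
  by apply/measurable_EFinP; exact: measurable_indic.
rewrite integral_indic// setIidl; last by move=> x [].
by rewrite EFinM fineK//; exact: nu_finE.
Qed.

(** Pointwise, the weighted indicators of the boxes add up to at most [361 rho], by [Wc_le_rho] and
    the overlap bound; this is then integrated against the measure. *)
Lemma sum_box_mass_le m' : {ae P, forall t, forall i,
  \sum_(j : 'I_m' * 'I_m') box_mass (val j.1, val j.2) (D i t) <= 361 * M}.
Proof.
have mO := @measurable_Omega R L.
have mB j : measurable_fun (Omega L) (fun x => (Wc j * \1_(cell_box L a j) x)%:E).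
  apply/measurable_EFinP; apply: measurable_funM => //.
  by apply: measurable_indic; exact: measurable_cell_box.
have ov_ge0 : (0 : R) <= 361 by exact: ler0n.
move: (361 : R) ov_ge0 (fun x => sum_cell_box_le L m' x a_gt0) => ov ov_ge0 ov_le.
apply: filterS total_rho => t tM i.
rewrite -lee_fin -sumEFin; under eq_bigr do rewrite box_mass_integral.
rewrite -ge0_integral_sum//; last by move=> j x _; rewrite lee_fin mulr_ge0.
rewrite EFinM.
apply: (@le_trans _ _ (ov%:E * \int[nu (D i t)]_(x in Omega L) (rho x)%:E)%E); last first.
  by apply: lee_wpmul2l => //; rewrite lee_fin.
rewrite -ge0_integralZl_EFin//; last exact/measurable_EFinP.
apply: ge0_le_integral => //.
- by move=> x _; apply: sume_ge0 => j _; rewrite lee_fin mulr_ge0.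
- exact: emeasurable_sum.
- by apply: emeasurable_funM => //; exact/measurable_EFinP.
move=> x Lx; rewrite sumEFin -EFinM lee_fin.
apply: (@le_trans _ _ (\sum_(j : 'I_m' * 'I_m')
    (\1_(cell_box L a (val j.1, val j.2)) x * rho x))).
  apply: ler_sum => j _; rewrite mulrC indicE.
  have [/set_mem xb|_] := boolP (x \in _); last by rewrite !mul0r.
  by rewrite !mul1r; exact: Wc_le_rho.
by rewrite -mulr_suml ler_wpM2r ?rho_ge0//; exact: ov_le.
Qed.

Lemma box_mass_le : {ae P, forall t, forall i j, box_mass j (D i t) <= M}.
Proof.
have mO := @measurable_Omega R L.
apply: filterS total_rho => t tM i j.
rewrite -lee_fin box_mass_integral; apply: le_trans (tM i).
apply: ge0_le_integral => //.
- by move=> x _; rewrite lee_fin mulr_ge0.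
- apply/measurable_EFinP; apply: measurable_funM => //.
  by apply: measurable_indic; exact: measurable_cell_box.
- exact/measurable_EFinP.
move=> x Lx; rewrite lee_fin indicE.
have [/set_mem xb|_] := boolP (x \in _); last by rewrite mulr0 rho_ge0.
by rewrite mulr1; exact: Wc_le_rho.
Qed.

(** On the box [Wc j * p <= rho * p <= c], and the box has area at most [(18 a)^2 = (81/16) h^2],
    rounded up to [6 h^2]. *)
Lemma mean_box_mass_le i j : \int[P]_t box_mass j (D i t) <= 6 * c * h ^+ 2.
Proof.
have mB := measurable_cell_box L a j.
have [mp p0 dens] := density i.
have BO : cell_box L a j `<=` Omega L by move=> x [].
have mpB := measurable_funS (@measurable_Omega R L) BO mp.
have : (\int[P]_t (box_mass j (D i t))%:E <= (6 * c * h ^+ 2)%:E)%E.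
  have -> : (\int[P]_t (box_mass j (D i t))%:E =
      (Wc j)%:E * mean_measure P (fun t => nu (D i t)) (cell_box L a j))%E.
    rewrite /mean_measure -ge0_integralZl_EFin//; last first.
      exact: (measurableT_comp (mnu mB)).
    by apply: eq_integral => t _; rewrite EFinM fineK//; exact: nu_finE.
  rewrite dens// -ge0_integralZl_EFin//; last 2 first.
  - by move=> x /BO Lx; rewrite lee_fin p0.
  - exact/measurable_EFinP.
  apply: (@le_trans _ _ (\int[leb2]_(x in cell_box L a j) c%:E)%E).
    apply: ge0_le_integral => //.
    - by move=> x /BO Lx; rewrite mule_ge0// lee_fin// p0.
    - by apply: emeasurable_funM => //; exact/measurable_EFinP.
    - move=> x xb; rewrite -EFinM lee_fin; apply: le_trans (rho_p_le (BO _ xb)).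
      by rewrite ler_wpM2r ?p0//; [exact: BO|exact: Wc_le_rho].
  rewrite integral_cst//; apply: (@le_trans _ _ (c%:E * ((18 * a) ^+ 2)%:E)%E).
    by apply: lee_wpmul2l; [rewrite lee_fin|exact: leb2_cell_box_le].
  rewrite -EFinM lee_fin /a.
  have -> : c * (18 * (h / 8)) ^+ 2 = (81 / 16) * (c * h ^+ 2) by field.
  have ch0 : 0 <= c * h ^+ 2 by rewrite mulr_ge0 ?sqr_ge0.
  have -> : 6 * c * h ^+ 2 = 6 * (c * h ^+ 2) by ring.
  by lra.
rewrite /Rintegral; case: (\int[P]_t _)%E => [s| |]//=.
by move=> _; apply: mulr_ge0; [exact: mulr_ge0|exact: sqr_ge0].
Qed.

Let imm_ge0 : 0 <= (n%:R * h ^+ 2)^-1.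
Proof. by rewrite invr_ge0; apply: mulr_ge0; [exact: ler0n|exact: sqr_ge0]. Qed.

Lemma kernel_averageE t w :
  kernel_average L K h (fun i => nu (D i t)) w =
  (n%:R * h ^+ 2)^-1 * \sum_i kernel_int w (D i t).
Proof.
rewrite /kernel_average invfM -mulrA; congr (_ * _).
rewrite mulr_sumr; apply: eq_bigr => i _.
rewrite -RintegralZl//; [exact: measurable_Omega|exact: integrable_kernel_at].
Qed.

Lemma measurable_kernel_average : measurable_fun setT
  (fun tx : T * plane R => kernel_average L K h (fun i => nu (D i tx.1)) tx.2).
Proof.
have mO := @measurable_Omega R L.
apply: (@measurable_plane_caratheodory R _ T
    (fun t w => kernel_average L K h (fun i => nu (D i t)) w)
    (fun t => (n%:R * h ^+ 2)^-1 * \sum_i (kappa / h * fine (nu (D i t) (Omega L))))).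
  move=> w; apply: (@eq_measurable_fun _ _ _ _ _
      (fun t => (n%:R * h ^+ 2)^-1 * \sum_i kernel_int w (D i t))).
    by move=> t _; rewrite kernel_averageE.
  apply: measurable_funM => //; apply: measurable_sum => i.
  exact: (measurableT_comp (measurable_kernel_int w)).
move=> t v w; rewrite !kernel_averageE -mulrBr -sumrB normrM.
rewrite (ger0_norm imm_ge0) -mulrA ler_wpM2l//.
apply: le_trans (ler_norm_sum _ _ _) _; rewrite mulr_suml; apply: ler_sum => i _.
rewrite /kernel_int -RintegralB//; [|exact: integrable_kernel_at|exact: integrable_kernel_at].
have -> : kappa / h * fine (nu (D i t) (Omega L)) * (`|v.1 - w.1| + `|v.2 - w.2|) =
  kappa * ((`|v.1 - w.1| + `|v.2 - w.2|) / h) * fine (nu (D i t) (Omega L)) by ring.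
have r0 : 0 <= kappa * ((`|v.1 - w.1| + `|v.2 - w.2|) / h).
  by rewrite mulr_ge0// divr_ge0 ?addr_ge0// ltW.
apply: (normr_Rintegral_le (X := diagram R) nu_fin) => //.
- by apply: measurable_funTS; apply: measurable_funB; exact: measurable_kernel_at.
- by move=> x Lx; rewrite indicE mem_set// mulr1; exact: kernel_at_lip.
Qed.

(** The event controls the deviation at all points of [S] at once and is chosen before [f] and [g],
    so it serves the whole class. [Q] is the price of replacing the weight [w] by a constant on each
    cell. *)
Theorem kernel_deviation (S : set (plane R)) (w : plane R -> R) (Q r h0 delta : R) :
  measurable S -> S `<=` Omega L -> (forall x, S x -> 0 < w x) -> 0 <= Q ->
  (forall x, S x -> w x <= Q * Wc (cell_of a x)) ->
  h <= h0 -> h0 < 1 -> 0 < delta < 1 -> 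
  let C := Q * conc_const kappa M (6 * c) 361 h0 in
  with_prob_ge P (1 - delta) [set t | forall f g : plane R -> R,
    measurable_fun S f -> measurable_fun S g ->
    (forall x, S x -> 0 <= g x) -> (forall x, S x -> f x = w x * g x) ->
    (\int[leb2]_(x in S) (g x)%:E <= r%:E)%E ->
    (`|(\int[leb2]_(x in S) (f x * kernel_average L K h (fun i => nu (D i t)) x))%R%:E -
      'E_P[fun t => (\int[leb2]_(x in S)
         (f x * kernel_average L K h (fun i => nu (D i t)) x))%R]| <=
      (r * deviation_bound C C n h delta)%:E)%E].
Proof.
move=> mS SO w0 Q0 wQ hh0 h01 d01 C.
have ov_ge0 : (0 : R) <= 361 by exact: ler0n.
have ah : 2 * a <= h by move: h_gt0; rewrite /a; lra.
have c6 : 0 <= 6 * c by rewrite mulr_ge0.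
have [A [mA PA HA]] := @uniform_concentration _ _ _ P n D a h kappa M (6 * c) 361 m
  (fun j w x => Wc j * kernel_int w x) box_mass indep h_gt0 a_gt0 ah kappa_ge0 M_ge0
  ov_ge0 (fun j w => measurable_funM (measurable_cst _) (measurable_kernel_int w))
  measurable_box_mass box_mass_ge0 (fun j w x => @kernel_int_le j w x)
  (fun j v w x => @kernel_int_lip j v w x) box_mass_le (sum_box_mass_le m)
  mean_box_mass_le h0 delta n_gt0 c6 hh0 h01 d01.
have n0 : 0 < n%:R :> R by rewrite ltr0n.
set Lam := ln ((delta * h ^+ 2)^-1) in HA *.
have /andP[d0 d1] := d01.
have h1 : h < 1 by exact: le_lt_trans h01.
have Lam0 : 0 <= Lam.
  rewrite ln_ge0// invf_ge1 ?mulr_gt0 ?exprn_gt0//.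
  by rewrite mulr_ile1 ?sqr_ge0 ?exprn_ile1 ?(ltW d0) ?(ltW d1) ?(ltW h1) ?(ltW h_gt0).
exists A; split => // t At f g mf mg g0 fg intg.
have [NM dev] := HA t At.
set mm := n%:R * h ^+ 2.
have mm0 : 0 < mm by rewrite mulr_gt0 ?exprn_gt0.
have in_grid x : S x -> [/\ 0 <= x.1, 0 <= x.2, ((cell_of a x).1 < m)%N & ((cell_of a x).2 < m)%N].
  move=> /SO[x1 [x12 x2]]; split; rewrite ?(ltW x1)//.
  - by rewrite ltW// (lt_trans x1).
  - by rewrite /m ltnS /cell_of/= le_truncn// ler_pM2r ?invr_gt0//; lra.
  - by rewrite /m ltnS /cell_of/= le_truncn// ler_pM2r ?invr_gt0//; lra.
have Wpos x : S x -> 0 < Wc (cell_of a x).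
  move=> Sx; have := lt_le_trans (w0 _ Sx) (wQ _ Sx).
  rewrite [in X in _ -> X]lt_neqAle Wc_ge0 andbT => QW; apply/eqP => W0.
  by move: QW; rewrite -W0 mulr0 ltxx.
have cell_S x : S x -> in_cell a (cell_of a x) x.
  by move=> /in_grid[? ? _ _]; exact: in_cell_of.
(* The crude bound for [deviation_duality]; its size is irrelevant. *)
have bound t' : (forall i j, box_mass j (D i t') <= M) -> forall x, S x ->
    w x * `|kernel_average L K h (fun i => nu (D i t')) x| <= Q * mm^-1 * (n%:R * (kappa * M)).
  move=> NM' x Sx; rewrite kernel_averageE -/mm normrM ger0_norm ?invr_ge0 ?(ltW mm0)//.
  apply: (@le_trans _ _ (Q * Wc (cell_of a x) * (mm^-1 * `|\sum_i kernel_int x (D i t')|))).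
    by rewrite ler_wpM2r ?wQ// mulr_ge0// invr_ge0 ltW.
  have -> : Q * Wc (cell_of a x) * (mm^-1 * `|\sum_i kernel_int x (D i t')|) =
    Q * mm^-1 * (Wc (cell_of a x) * `|\sum_i kernel_int x (D i t')|) by ring.
  rewrite ler_wpM2l ?mulr_ge0 ?invr_ge0 ?(ltW mm0)//.
  rewrite -[X in X * _](ger0_norm (Wc_ge0 _)) -normrM mulr_sumr.
  apply: le_trans (ler_norm_sum _ _ _) _.
  have -> : n%:R * (kappa * M) = \sum_(i < n) (kappa * M).
    by rewrite sumr_const card_ord mulr_natl.
  apply: ler_sum => i _; apply: le_trans (kernel_int_le _ (cell_S _ Sx)) _.
  by rewrite ler_wpM2l.
have boundae x : S x -> {ae P, forall t', w x * `|kernel_average L K h (fun i => nu (D i t')) x|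
    <= Q * mm^-1 * (n%:R * (kappa * M))}.
  by move=> Sx; apply: filterS box_mass_le => t' NM'; exact: bound.
set conc := conc_const _ _ _ _ _ in C HA dev *.
set mx := Num.max Lam _ in dev.
have devx x : S x -> w x * `|kernel_average L K h (fun i => nu (D i t)) x -
    \int[P]_t' kernel_average L K h (fun i => nu (D i t')) x| <= Q * conc * mx / mm.
  move=> Sx; have [x1 x2 j1 j2] := in_grid _ Sx.
  have iF i : P.-integrable setT (fun t' => (kernel_int x (D i t'))%:E).
    apply: (@ae_bounded_integrable _ _ _ _ _ ((Wc (cell_of a x))^-1 * (kappa * M))).
      exact: (measurableT_comp (measurable_kernel_int x)).
    apply: filterS box_mass_le => t' NM'.
    rewrite ler_pdivlMl ?Wpos// -[X in X * _](ger0_norm (Wc_ge0 _)) -normrM.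
    by apply: le_trans (kernel_int_le _ (cell_S _ Sx)) _; rewrite ler_wpM2l.
  have devE : \sum_i (Wc (cell_of a x) * kernel_int x (D i t) -
      \int[P]_u (Wc (cell_of a x) * kernel_int x (D i u))) =
      Wc (cell_of a x) * (\sum_i kernel_int x (D i t) - \sum_i \int[P]_u kernel_int x (D i u)).
    rewrite -sumrB mulr_sumr; apply: eq_bigr => i _.
    by rewrite (RintegralZl _ measurableT (iF i)) -mulrBr.
  have meanE : \int[P]_t' kernel_average L K h (fun i => nu (D i t')) x =
      mm^-1 * \sum_i \int[P]_u kernel_int x (D i u).
    under eq_Rintegral do rewrite kernel_averageE.
    have isum : P.-integrable setT (EFin \o (fun t' => \sum_i kernel_int x (D i t'))).
      have : P.-integrable setT (fun t' => (\sum_(i < n) (kernel_int x (D i t'))%:E)%E).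
        exact: integrable_sum.
      by apply: eq_integrable => // u _ /=; rewrite sumEFin.
    rewrite (RintegralZl _ measurableT isum); congr (_ * _).
    rewrite /Rintegral; under eq_integral do rewrite -sumEFin.
    rewrite integral_sum// -sum_fine// => i _.
    by apply: integrable_fin_num => //; exact: iF.
  have := dev x x1 x2 j1 j2; rewrite devE => {}dev.
  rewrite meanE kernel_averageE -/mm -mulrBr normrM ger0_norm ?invr_ge0 ?(ltW mm0)//.
  set z := (\sum_i kernel_int x (D i t) - _) in dev *.
  apply: (@le_trans _ _ (Q * Wc (cell_of a x) * (mm^-1 * `|z|))).
    by rewrite ler_wpM2r ?wQ// mulr_ge0// invr_ge0 ltW.
  have -> : Q * Wc (cell_of a x) * (mm^-1 * `|z|) =
    Q * mm^-1 * (Wc (cell_of a x) * `|z|) by ring.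
  have -> : Q * conc * mx / mm = Q * mm^-1 * (conc * mx) by ring.
  rewrite ler_wpM2l ?mulr_ge0 ?invr_ge0 ?(ltW mm0)//.
  by move: dev; rewrite normrM ger0_norm.
have conc0 : 0 <= conc.
  by apply: conc_const_ge0 => //; rewrite h01 (lt_le_trans h_gt0).
have mx0 : 0 <= mx by rewrite le_max Lam0.
have B0 : 0 <= Q * conc * mx / mm.
  by rewrite !mulr_ge0// invr_ge0 ltW.
(* With [mm = n h^2], one has [sqrt (1 / mm) * sqrt Lam = sqrt (mm * Lam) / mm]. *)
have -> : deviation_bound C C n h delta = Q * conc * mx / mm.
  have C0 : 0 <= C by rewrite mulr_ge0.
  rewrite /deviation_bound -/Lam -/mm -[C * _ * Lam]mulrA -[C * _ * Num.sqrt Lam]mulrA.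
  rewrite -maxr_pMr// -mulrA; congr (_ * _); rewrite /mx maxr_pMl ?invr_ge0 ?(ltW mm0)//.
  congr (Num.max _ _); first by rewrite mulrC.
  rewrite sqrtrM ?(ltW mm0)// sqrtrV ?(ltW mm0)//.
  have s0 : Num.sqrt mm != 0 by rewrite gt_eqF ?sqrtr_gt0.
  rewrite -[X in _ / X](sqr_sqrtr (ltW mm0)); field.
  exact: s0.
have := @deviation_duality _ _ _ _ _ P (leb2_sigma R) S f g w
  (fun t x => kernel_average L K h (fun i => nu (D i t)) x)
  _ _ r t mS mf mg measurable_kernel_average w0 g0 fg B0 intg boundae
  (fun x Sx => bound t NM x Sx) devx.
exact.
Qed.

End KernelEstimator.

(** * Cell weights for the intensity, and conclusion *)

Lemma normr_le_supnorm (R : realType) (A : set (plane R)) (f : plane R -> R) x :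
  sup_finite A f -> A x -> `|f x| <= supnorm A f.
Proof. by move=> bf Ax; apply: ub_le_sup => //; exists x. Qed.

Lemma with_prob_ge_le (R : realType) d (T : measurableType d) (P : probability T R)
    (c : R) (E F : set T) :
  E `<=` F -> with_prob_ge P c E -> with_prob_ge P c F.
Proof. by move=> EF [A [mA AE PA]]; exists A; split => // t /AE /EF. Qed.

(* The difference [x.2 - x.1] varies by at most [9 / 4 * h] between the corner of
   the cell [j] and a point of [cell_box L (h / 8) j]; cells too close to the
   diagonal get weight [0 `^ q = 0]. *)
Definition corner_weight {R : realType} (h q : R) (j : nat * nat) : R :=
  Num.max 0 (((j.2%:R - j.1%:R) * (h / 8) - 9 / 4 * h) / Num.sqrt 2) `^ q.

Lemma corner_weight_le_dist (R : realType) (L h q : R) j x : 0 < q ->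
  cell_box L (h / 8) j x -> corner_weight h q j <= dist_diag L x `^ q.
Proof.
move=> q0 [Lx]; rewrite !ler_distl => /andP[_ x1] /andP[x2 _].
have s2 : 0 < Num.sqrt (2 : R) by rewrite sqrtr_gt0.
have [_ [x12 _]] := Lx.
rewrite dist_diag_Omega//; apply: ge0_ler_powR; rewrite ?nnegrE ?(ltW q0) ?le_max ?lexx//.
  by rewrite divr_ge0 ?(ltW s2)// subr_ge0 ltW.
rewrite ge_max divr_ge0 ?(ltW s2) ?subr_ge0 ?(ltW x12)//=.
by rewrite ler_pM2r ?invr_gt0//; lra.
Qed.

(** From the corner to [x] the difference of coordinates grows by at most [h / 8], so [B] falls
    short of the distance [D] by at most [(9/4 + 1/8) h / sqrt 2 <= (95/56) h]. This is less than
    [2 h <= D], hence [B > 0], and [D - h <= 4 B] follows. Here the domain at distance [2 h] and the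
    small side of the cells come into play. *)
Lemma weight_le_corner_weight (R : realType) (L h q : R) x : 0 < h -> 0 < q ->
  Omega_ge L (2 * h) x ->
  (dist_diag L x - h) `^ q <= 4 `^ q * corner_weight h q (cell_of (h / 8) x).
Proof.
move=> h0 q0 [Lx]; rewrite dist_diag_Omega//.
have [x1 [x12 _]] := Lx.
have s0 : 0 < Num.sqrt (2 : R) by rewrite sqrtr_gt0.
have s2 : 7 / 5 <= Num.sqrt (2 : R).
  rewrite -[leLHS]ger0_norm; last by lra.
  by rewrite -sqrtr_sqr ler_wsqrtr// expr2; lra.
have a0 : 0 < h / 8 by rewrite divr_gt0.
have [/andP[j1 _] /andP[_ j2]] := in_cell_of a0 (ltW x1) (ltW (lt_trans x1 x12)).
set j := cell_of _ _ in j1 j2 *.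
rewrite -natr1 mulrDl mul1r in j2.
set D := (x.2 - x.1) / Num.sqrt 2 => Dh.
rewrite /corner_weight; set B := (_ / Num.sqrt 2 : R).
have hB : D - 19 / 8 * h / Num.sqrt 2 <= B.
  rewrite /D /B -mulrBl ler_pM2r ?invr_gt0// mulrBl; lra.
have hs : h / Num.sqrt 2 <= 5 / 7 * h.
  by rewrite ler_pdivrMr// mulrAC; have := ler_wpM2l (ltW h0) s2; lra.
have DB : D - h <= 4 * B.
  have : 19 / 8 * h / Num.sqrt 2 = 19 / 8 * (h / Num.sqrt 2) by ring.
  by lra.
have B0 : 0 <= B by lra.
rewrite max_r// -powRM//; apply: ge0_ler_powR; rewrite ?nnegrE ?(ltW q0)//; lra.
Qed.

Theorem theorem2p7 (R : realType) (LK h0 : R) (h0_gt0 : 0 < h0) (h0_lt1 : h0 < 1) :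
  exists C1 C2 C1' C2' : R -> R -> R -> R -> R -> R,
  forall (L : R) (K : plane R -> R) (h q M r : R) (n : nat)
    (d : measure_display) (T : measurableType d) (P : probability T R)
    (D : 'I_n -> {RV P >-> diagram R}) (p ptilde : plane R -> R),
  let pbar := fun w => dist_diag L w `^ q * p w in
  0 < L -> kernel_conditions K LK -> 0 < h <= h0 ->
  0 < q -> 0 < M -> 0 < r -> (0 < n)%N ->
  iid_on L D -> is_intensity L D p -> is_density_function L D ptilde ->
  {ae P, forall t, forall i,
    (\int[pers_measure (D i t)]_(w in Omega L) (dist_diag L w `^ q)%:E
       < M%:E)%E} ->
  sup_finite (Omega L) pbar -> sup_finite (Omega L) ptilde ->
  (forall delta : R, 0 < delta < 1 ->
    with_prob_ge P (1 - delta)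
      [set t | (sup_deviation P (class_intensity L h q r)
                  (Psi_hat L K h D) t <=
        (r * deviation_bound
           (C1 M (supnorm setT K) (l2norm K) (supnorm (Omega L) pbar) q)
           (C2 M (supnorm setT K) (l2norm K) (supnorm (Omega L) pbar) q)
           n h delta)%:E)%E]) /\
  (forall delta : R, 0 < delta < 1 ->
    with_prob_ge P (1 - delta)
      [set t | (sup_deviation P (class_density L r)
                  (Psi_check L K h D) t <=
        (r * deviation_bound
           (C1' M (supnorm setT K) (l2norm K) (supnorm (Omega L) ptilde) q)
           (C2' M (supnorm setT K) (l2norm K) (supnorm (Omega L) ptilde) q)
           n h delta)%:E)%E]).
Proof.
(* A single [kappa] must bound both [|K|] and its Lipschitz constant. *)
pose ka (k : R) := Num.max k LK.
(* [4^q] compares the weight with its value on the cell, [6 * pb] bounds the mean mass of a box per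
   [h^2], and 361 is the overlap. *)
exists (fun M k _ pb q => 4 `^ q * conc_const (ka k) M (6 * pb) 361 h0).
exists (fun M k _ pb q => 4 `^ q * conc_const (ka k) M (6 * pb) 361 h0).
exists (fun _ k _ pt _ => 1 * conc_const (ka k) 1 (6 * pt) 361 h0).
exists (fun _ k _ pt _ => 1 * conc_const (ka k) 1 (6 * pt) 361 h0).
move=> L K h q M r n d T P D p ptilde pbar L0 HK /andP[h_gt0 hh0] q0 M0 r0 n0.
move=> [indep _ inO] int_p int_pt totM bp bpt.
set kappa := ka (supnorm setT K).
have O1 : Omega L (L / 2, L) by rewrite /Omega/=; lra.
have K_le x : `|K x| <= kappa.
  by rewrite le_max normr_le_supnorm//; exact: kernel_bounded HK.
have K_lip x y : `|K x - K y| <= kappa * enorm (x - y).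
  apply: le_trans (kernel_lipschitz HK x y) _.
  by rewrite ler_wpM2r ?sqrtr_ge0// le_max lexx orbT.
have K_support := kernel_support HK.
have mO := @measurable_Omega R L.
have mdist := @measurable_dist_diag R L.
split => delta delta01.
- have mS := @measurable_Omega_ge R L (2 * h).
  have SO : Omega_ge L (2 * h) `<=` Omega L by move=> x [].
  have lpos x : Omega_ge L (2 * h) x -> 0 < dist_diag L x - h by move=> [_]; lra.
  have mrho : measurable_fun (Omega L) (fun x => dist_diag L x `^ q).
    exact: (measurableT_comp (measurable_powR q)).
  have rho_ge0 x : Omega L x -> 0 <= dist_diag L x `^ q by rewrite powR_ge0.
  have total : {ae P, forall t, forall i, (\int[pers_measure (D i t)]_(x in Omega L)
      (dist_diag L x `^ q)%:E <= M%:E)%E}.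
    by apply: filterS totM => t tM i; exact: ltW.
  have pb_ge0 : 0 <= supnorm (Omega L) pbar.
    exact: le_trans (normr_le_supnorm bp O1).
  have pb_le x : Omega L x -> dist_diag L x `^ q * p x <= supnorm (Omega L) pbar.
    by move=> Lx; apply: le_trans (normr_le_supnorm bp Lx); exact: ler_norm.
  have w_gt0 x : Omega_ge L (2 * h) x -> 0 < (dist_diag L x - h) `^ q.
    by move=> Sx; rewrite powR_gt0// lpos.
  have := kernel_deviation (nu := pers_measure) (fun A mA => measurable_pers_measure mA)
    (@pers_measure_finite R) indep n0 h_gt0 K_support K_le K_lip (ltW M0) mrho rho_ge0
    total int_p pb_ge0 pb_le (fun j => powR_ge0 _ q)
    (fun j x => @corner_weight_le_dist _ L h q j x q0) r mS SO w_gt0 (powR_ge0 4 q)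
    (fun x => @weight_le_corner_weight _ L h q x h_gt0 q0) hh0 h0_lt1 delta01.
  apply: with_prob_ge_le => t Ht /=; apply: ge_ereal_sup => _ [f [mf f0 fr] <-].
  (* The dual function is the integrand in the definition of the class, so [r] bounds its integral;
     the weight is the inverse power, positive because the distance is at least [2 h]. *)
  apply: (Ht f (fun x => (dist_diag L x - h) `^ (- q) * f x)) => //.
  + apply: measurable_funM => //.
    apply: (measurableT_comp (measurable_powR (- q))).
    by apply: measurable_funB => //; exact: measurable_funS mdist.
  + by move=> x Sx; rewrite mulr_ge0 ?powR_ge0// f0.
  + by move=> x Sx; rewrite mulrA powRN mulfV ?mul1r// gt_eqF// w_gt0.
(* A normalized measure has mass at most 1, so [rho], [M] and all weights are 1, and the dual
   function is [f] itself. *)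
- have total : {ae P, forall t, forall i, (\int[npers_measure (D i t)]_(x in Omega L)
      1%:E <= 1%:E)%E}.
    apply: aeW => t i; rewrite integral_cst// mul1e.
    apply: le_trans (npers_measureT_le1 (D i t)).
    by apply: le_measure; rewrite ?inE.
  have pt_ge0 : 0 <= supnorm (Omega L) ptilde.
    exact: le_trans (normr_le_supnorm bpt O1).
  have pt_le x : Omega L x -> 1 * ptilde x <= supnorm (Omega L) ptilde.
    by move=> Lx; rewrite mul1r (le_trans _ (normr_le_supnorm bpt Lx))// ler_norm.
  have w_le (x : plane R) : Omega L x -> 1 <= 1 * 1 :> R by rewrite mulr1.
  have := kernel_deviation (nu := npers_measure) (rho := fun=> 1)
    (fun A mA => measurable_npers_measure mA) (@npers_measure_finite R) indep n0 h_gt0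
    K_support K_le K_lip ler01 (measurable_cst _) (fun _ _ => ler01) total int_pt pt_ge0
    pt_le (Wc := fun=> 1) (fun=> ler01) (fun _ _ _ => lexx _) r mO (@subset_refl _ _)
    (w := fun=> 1) (fun _ _ => ltr01) ler01 w_le hh0 h0_lt1 delta01.
  apply: with_prob_ge_le => t Ht /=; apply: ge_ereal_sup => _ [f [mf f0 fr] <-].
  by apply: (Ht f f) => // x _; rewrite mul1r.
Qed.
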